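(* Let $R$ be a ring, ${}'\mathcal{C}={}'\mathcal{C}_R$ and $\mathfrak{a}=\mathrm{ass}_R({}'\mathcal{C})$. The following statements are equivalent. 1. ${}'Q_{l,\mathrm{cl}}(R)$ is a semisimple Artinian ring. 2. (a) $\mathfrak{a}$ is a semiprime ideal of $R$ and the set $\mathrm{Min}_R(\mathfrak{a})$ is finite. (b) For each $\mathfrak{p}\in\mathrm{Min}_R(\mathfrak{a})$, the set $S_{\mathfrak{p}}:=\{c\in R\mid c+\mathfrak{p}\in\mathcal{C}_{R/\mathfrak{p}}\}$ is a left denominator set of the ring $R$ with $\mathrm{ass}_R(S_{\mathfrak{p}})=\mathfrak{p}$. (c) For each $\mathfrak{p}\in\mathrm{Min}_R(\mathfrak{a})$, the ring $S_{\mathfrak{p}}^{-1}R$ is a simple Artinian ring. (d) The set $\overline{{}'\mathcal{C}}:=\{c+\mathfrak{a}\mid c\in{}'\mathcal{C}\}$ is a dense subset of $\mathcal{C}_{R/\mathfrak{a}}$. Let $\overline{R}=R/\mathfrak{a}$ and $\overline{\mathfrak{p}}=\mathfrak{p}/\mathfrak{a}$ for $\mathfrak{p}\in\mathrm{Min}_R(\mathfrak{a})$. If one of the equivalent conditions holds then: (i) $\{S\in\mathrm{max.Den}_l(R)\mid{}'\mathcal{C}\subseteq S\}=\{S_{\mathfrak{p}}\mid\mathfrak{p}\in\mathrm{Min}_R(\mathfrak{a})\}$ and $\mathrm{ass}_R(S_{\mathfrak{p}})=\mathfrak{p}$; (ii) $\mathrm{max.Den}_l(\overline{R})=\{S_{\overline{\mathfrak{p}}}\mid\overline{\mathfrak{p}}\in\mathrm{Min}(\overline{R})\}$,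 where $S_{\overline{\mathfrak{p}}}:=\{\overline{r}\in\overline{R}\mid\overline{r}+\overline{\mathfrak{p}}\in\mathcal{C}_{\overline{R}/\overline{\mathfrak{p}}}\}$, and $\mathrm{ass}_{\overline{R}}(S_{\overline{\mathfrak{p}}})=\overline{\mathfrak{p}}$; (iii) for all $\mathfrak{p}\in\mathrm{Min}_R(\mathfrak{a})$, $S_{\mathfrak{p}}^{-1}R\simeq S_{\overline{\mathfrak{p}}}^{-1}\overline{R}$ is a simple Artinian ring; (iv) ${}'Q_{l,\mathrm{cl}}(R)\simeq\prod_{\mathfrak{p}\in\mathrm{Min}_R(\mathfrak{a})}S_{\mathfrak{p}}^{-1}R\simeq\prod_{\overline{\mathfrak{p}}\in\mathrm{Min}(\overline{R})}S_{\overline{\mathfrak{p}}}^{-1}\overline{R}\simeq Q_{l,\mathrm{cl}}(\overline{R})$ (semisimple Artinian rings).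
   Context: Rings are associative with $1$. For a nonempty subset $S$ of a ring $R$, $\mathrm{ass}_R(S):=\{r\in R\mid sr=0\text{ for some }s\in S\}$. ${}'\mathcal{C}_R$ is the set of left regular elements of $R$: those $r\in R$ such that $xr=0$ ($x\in R$) implies $x=0$. $\mathcal{C}_R$ is the set of regular elements: those $r$ such that $xr=0$ implies $x=0$ and $rx=0$ implies $x=0$. $\mathrm{Min}_R(I)$ is the set of minimal prime ideals over an ideal $I$, and $\mathrm{Min}(R)=\mathrm{Min}_R(0)$. A multiplicative set is a subset $S$ with $1\in S$, $SS\subseteq S$, $0\notin S$. It is a left Ore set if $Sr\cap Rs\neq\emptyset$ for all $r\in R$, $s\in S$. It is a left denominator set if it is left Ore and $rs=0$ with $r\in R$, $s\in S$ implies $r\in\mathrm{ass}_R(S)$; then $\mathrm{ass}_R(S)$ is an ideal and the left localization $S^{-1}R$ exists. $\mathrm{max.Den}_l(R)$ is the set of left denominator sets of $R$ that are maximal with respect to inclusion. For multiplicative sets $S\subseteq T$ of $R$, $S$ is dense in $T$ if for each $t\in T$ there is $r\in R$ with $rt\in S$. ${}'Q_{l,\mathrm{cl}}(R):={}'\mathcal{C}_R^{-1}R$ and $Q_{l,\mathrm{cl}}(R):=\mathcal{C}_R^{-1}R$; these exist exactly when ${}'\mathcal{C}_R$, respectively $\mathcal{C}_R$, is a left denominator set, and an assertion that such a ring has a property includes the assertion that it exists. *)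

(* Defs.v *)
From HB Require Import structures.
From mathcomp Require Import all_boot all_algebra.
From mathcomp Require Import boolp classical_sets cardinality.

Set Implicit Arguments.
Unset Strict Implicit.
Unset Printing Implicit Defensive.

Import GRing.Theory.

Local Open Scope classical_set_scope.
Local Open Scope ring_scope.

(* Rings are pzRingType: associative with 1, the zero ring being allowed.
   The zero ring has no multiplicative set, hence no localization. *)

Section Ideals.
Variable R : pzRingType.
Implicit Types (I J K P : set R).

Definition left_ideal I : Prop :=
  [/\ I 0, (forall x y, I x -> I y -> I (x + y))
    & forall r x, I x -> I (r * x)].

Definition two_sided_ideal I : Prop :=
  left_ideal I /\ (forall r x, I x -> I (x * r)).

(* [J K `<=` P] is tested on products of elements, since [P] is closed
   under sums. *)
Definition prime_ideal P : Prop :=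
  [/\ two_sided_ideal P, P != setT
    & forall J K, two_sided_ideal J -> two_sided_ideal K ->
        (forall x y, J x -> K y -> P (x * y)) -> J `<=` P \/ K `<=` P].

Definition semiprime_ideal I : Prop :=
  two_sided_ideal I /\
  (forall J, two_sided_ideal J ->
     (forall x y, J x -> J y -> I (x * y)) -> J `<=` I).

Definition minimal_primes I : set (set R) :=
  [set P | [/\ prime_ideal P, I `<=` P
    & forall P', prime_ideal P' -> I `<=` P' -> P' `<=` P -> P' = P]].

End Ideals.

(* The quotient of [R] by the two-sided ideal generated by [I], hence [R / I]
   when [I] is a two-sided ideal. Taking the generated ideal makes [quotient I]
   a ring for every subset [I], without a proof argument. *)
Section Quotient.
Variables (R : pzRingType) (I : set R).

Definition ideal_gen : set R := smallest (@two_sided_ideal R) I.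

Lemma ideal_gen_ideal : two_sided_ideal ideal_gen.
Proof.
split; first split.
- by move=> J [[[]]].
- move=> x y Ix Iy J CJ; case: (CJ) => [[[_ + _] _] _]; apply.
  + exact: Ix.
  + exact: Iy.
- by move=> r x Ix J CJ; case: (CJ) => [[[_ _ +] _] _]; apply; exact: Ix.
- by move=> r x Ix J CJ; case: (CJ) => [[_ +] _]; apply; exact: Ix.
Qed.

Lemma ideal_gen_id : two_sided_ideal I -> ideal_gen = I.
Proof.
move=> hI; apply/seteqP; split=> x; first by apply; split.
by move=> Ix J [_]; apply.
Qed.

Let gen0 : ideal_gen 0. Proof. by case: ideal_gen_ideal => [[]]. Qed.
Let genD x y : ideal_gen x -> ideal_gen y -> ideal_gen (x + y).
Proof. by case: ideal_gen_ideal => [[_ + _] _]; apply. Qed.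
Let genMl r x : ideal_gen x -> ideal_gen (r * x).
Proof. by case: ideal_gen_ideal => [[_ _ +] _]; apply. Qed.
Let genMr r x : ideal_gen x -> ideal_gen (x * r).
Proof. by case: ideal_gen_ideal => [_]; apply. Qed.
Let genN x : ideal_gen x -> ideal_gen (- x).
Proof. by rewrite -mulN1r; apply: genMl. Qed.

Definition quotient_rel (x y : R) : bool := `[< ideal_gen (x - y) >].

Lemma quotient_relE x y : quotient_rel x y <-> ideal_gen (x - y).
Proof. by split=> [/asboolP|/asboolP]. Qed.

Lemma quotient_equiv : equiv_class_of quotient_rel.
Proof.
have sym x y : quotient_rel x y -> quotient_rel y x.
  by move=> /quotient_relE/genN; rewrite opprB => /quotient_relE.
split=> [x|x y|y x z].
- by apply/quotient_relE; rewrite subrr.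
- by apply/idP/idP; apply: sym.
- move=> /quotient_relE xy /quotient_relE yz; apply/quotient_relE.
  by have := genD xy yz; rewrite addrA subrK.
Qed.

Canonical quotient_equiv_rel := EquivRelPack quotient_equiv.

Definition quotient := {eq_quot quotient_equiv_rel}%qT.
HB.instance Definition _ := Choice.copy quotient {eq_quot quotient_equiv_rel}%qT.

Definition quotient_map (x : R) : quotient := (\pi_({eq_quot quotient_equiv_rel}) x)%qT.

Lemma quotient_map_eq x y :
  quotient_map x = quotient_map y <-> ideal_gen (x - y).
Proof.
rewrite -quotient_relE; split.
  by move=> /eqquotP.
by move=> ?; apply/eqquotP.
Qed.

Lemma quotient_map_surj (q : quotient) : exists x, quotient_map x = q.
Proof. by exists (repr q); rewrite /quotient_map reprK. Qed.

Let rp (q : quotient) : R := repr q.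
Let rpK q : quotient_map (rp q) = q. Proof. exact: reprK. Qed.

Let qadd (p q : quotient) : quotient := quotient_map (rp p + rp q).
Let qopp (p : quotient) : quotient := quotient_map (- rp p).
Let qmul (p q : quotient) : quotient := quotient_map (rp p * rp q).

Let rp_gen x : ideal_gen (rp (quotient_map x) - x).
Proof. by apply/quotient_map_eq; rewrite rpK. Qed.

Let qaddE x y : qadd (quotient_map x) (quotient_map y) = quotient_map (x + y).
Proof.
apply/quotient_map_eq; set x' := rp _; set y' := rp (quotient_map y).
by rewrite opprD addrACA; apply: genD; apply: rp_gen.
Qed.

Let qoppE x : qopp (quotient_map x) = quotient_map (- x).
Proof. by apply/quotient_map_eq; rewrite -opprD; apply: genN; apply: rp_gen. Qed.

Let qmulE x y : qmul (quotient_map x) (quotient_map y) = quotient_map (x * y).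
Proof.
apply/quotient_map_eq; set x' := rp _; set y' := rp (quotient_map y).
have -> : x' * y' - x * y = (x' - x) * y' + x * (y' - y).
  by rewrite mulrBl mulrBr addrA subrK.
by apply: genD; [apply: genMr|apply: genMl]; apply: rp_gen.
Qed.

Let qaddA : associative qadd.
Proof.
move=> p q r; rewrite -(rpK p) -(rpK q) -(rpK r).
by rewrite !qaddE addrA.
Qed.
Let qaddC : commutative qadd.
Proof. by move=> p q; rewrite /qadd addrC. Qed.
Let qadd0 : left_id (quotient_map 0) qadd.
Proof. by move=> p; rewrite -(rpK p) qaddE add0r. Qed.
Let qaddN : left_inverse (quotient_map 0) qopp qadd.
Proof. by move=> p; rewrite -(rpK p) qoppE qaddE addNr. Qed.

HB.instance Definition _ :=
  GRing.isZmodule.Build quotient qaddA qaddC qadd0 qaddN.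

Let qmulA : associative qmul.
Proof. by move=> p q r; rewrite -(rpK p) -(rpK q) -(rpK r) !qmulE mulrA. Qed.
Let qmul1 : left_id (quotient_map 1) qmul.
Proof. by move=> p; rewrite -(rpK p) qmulE mul1r. Qed.
Let qmulr1 : right_id (quotient_map 1) qmul.
Proof. by move=> p; rewrite -(rpK p) qmulE mulr1. Qed.
Let qmulDl : left_distributive qmul qadd.
Proof.
by move=> p q r; rewrite -(rpK p) -(rpK q) -(rpK r) !(qmulE, qaddE) mulrDl.
Qed.
Let qmulDr : right_distributive qmul qadd.
Proof.
by move=> p q r; rewrite -(rpK p) -(rpK q) -(rpK r) !(qmulE, qaddE) mulrDr.
Qed.

HB.instance Definition _ :=
  GRing.Zmodule_isPzRing.Build quotient qmulA qmul1 qmulr1 qmulDl qmulDr.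

Let quotient_map_additive : zmod_morphism quotient_map.
Proof.
move=> x y; rewrite [RHS](_ : _ = qadd (quotient_map x) (qopp (quotient_map y))) //.
by rewrite qoppE qaddE.
Qed.

Let quotient_map_multiplicative : monoid_morphism quotient_map.
Proof. by split=> // x y; rewrite -qmulE. Qed.

HB.instance Definition _ :=
  GRing.isZmodMorphism.Build R quotient quotient_map quotient_map_additive.
HB.instance Definition _ :=
  GRing.isMonoidMorphism.Build R quotient quotient_map
    quotient_map_multiplicative.

Lemma quotient_map_eq0 x : quotient_map x = 0 <-> ideal_gen x.
Proof. by rewrite -(rmorph0 quotient_map) quotient_map_eq subr0. Qed.

End Quotient.
Arguments quotient_map {R} I x.

Section Product.
Variables (I : Type) (Q : I -> pzRingType).

Definition ring_product : Type := forall i, Q i.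

HB.instance Definition _ := gen_eqMixin ring_product.
HB.instance Definition _ := gen_choiceMixin ring_product.

Let pzero : ring_product := fun i => 0.
Let popp (f : ring_product) : ring_product := fun i => - f i.
Let padd (f g : ring_product) : ring_product := fun i => f i + g i.
Let pone : ring_product := fun i => 1.
Let pmul (f g : ring_product) : ring_product := fun i => f i * g i.

Let paddA : associative padd.
Proof. by move=> f g h; apply: functional_extensionality_dep => i; exact: addrA. Qed.
Let paddC : commutative padd.
Proof. by move=> f g; apply: functional_extensionality_dep => i; exact: addrC. Qed.
Let padd0 : left_id pzero padd.
Proof. by move=> f; apply: functional_extensionality_dep => i; exact: add0r. Qed.
Let paddN : left_inverse pzero popp padd.
Proof. by move=> f; apply: functional_extensionality_dep => i; exact: addNr. Qed.

HB.instance Definition _ :=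
  GRing.isZmodule.Build ring_product paddA paddC padd0 paddN.

Let pmulA : associative pmul.
Proof. by move=> f g h; apply: functional_extensionality_dep => i; exact: mulrA. Qed.
Let pmul1 : left_id pone pmul.
Proof. by move=> f; apply: functional_extensionality_dep => i; exact: mul1r. Qed.
Let pmulr1 : right_id pone pmul.
Proof. by move=> f; apply: functional_extensionality_dep => i; exact: mulr1. Qed.
Let pmulDl : left_distributive pmul padd.
Proof. by move=> f g h; apply: functional_extensionality_dep => i; exact: mulrDl. Qed.
Let pmulDr : right_distributive pmul padd.
Proof. by move=> f g h; apply: functional_extensionality_dep => i; exact: mulrDr. Qed.

HB.instance Definition _ :=
  GRing.Zmodule_isPzRing.Build ring_product pmulA pmul1 pmulr1 pmulDl pmulDr.

End Product.

Definition ring_iso (A B : pzRingType) : Prop :=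
  exists f : {rmorphism A -> B}, bijective f.

Definition left_artinian (A : pzRingType) : Prop :=
  forall J : nat -> set A,
    (forall n, left_ideal (J n)) -> (forall n, J n.+1 `<=` J n) ->
    exists n, forall m, (n <= m)%N -> J m = J n.

(* Right ideals of [A] are the left ideals of the converse ring [A^c]. *)
Definition artinian (A : pzRingType) : Prop :=
  left_artinian A /\ left_artinian A^c.

Definition minimal_left_ideal (A : pzRingType) (M : set A) : Prop :=
  [/\ left_ideal M, M <> [set 0]
    & forall J, left_ideal J -> J `<=` M -> J = [set 0] \/ J = M].

(* [A] is the sum of its minimal left ideals, the sum of a family of left
   ideals being the smallest left ideal that contains all of them. *)
Definition semisimple (A : pzRingType) : Prop :=
  smallest (@left_ideal A) (\bigcup_(M in @minimal_left_ideal A) M) = setT.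

Definition semisimple_artinian (A : pzRingType) : Prop :=
  semisimple A /\ artinian A.

Definition simple_ring (A : pzRingType) : Prop :=
  (1 : A) <> 0 /\
  (forall J : set A, two_sided_ideal J -> J = [set 0] \/ J = setT).

Definition simple_artinian (A : pzRingType) : Prop :=
  simple_ring A /\ artinian A.

Section Localization.
Variable R : pzRingType.
Implicit Types (S T : set R).

Definition ass S : set R := [set r | exists2 s, S s & s * r = 0].

Definition left_regular : set R := [set r | forall x, x * r = 0 -> x = 0].

Definition regular : set R :=
  [set r | (forall x, x * r = 0 -> x = 0) /\ (forall x, r * x = 0 -> x = 0)].

Definition multiplicative_set S : Prop :=
  [/\ S 1, (forall s t, S s -> S t -> S (s * t)) & ~ S 0].

Definition left_ore S : Prop :=
  multiplicative_set S /\
  (forall r s, S s -> exists t x, S t /\ t * r = x * s).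

Definition left_denominator S : Prop :=
  left_ore S /\ (forall r s, S s -> r * s = 0 -> ass S r).

Definition max_left_denominator : set (set R) :=
  [set S | left_denominator S /\
    (forall T, left_denominator T -> S `<=` T -> T = S)].

Definition dense_in S T : Prop :=
  [/\ multiplicative_set S, multiplicative_set T, S `<=` T
    & forall t, T t -> exists r, S (r * t)].

(* A left localization of [R] at the left denominator set [S]: a ring
   [S^-1 R] with a morphism [r |-> r / 1] of kernel [ass S] that inverts [S]
   and such that every element is a left fraction [s^-1 r]. It is unique up to
   isomorphism. *)
Record left_localization S := LeftLocalization {
  loc_ring :> pzRingType;
  loc_map : {rmorphism R -> loc_ring};
  loc_denominator : left_denominator S;
  loc_inv : forall s, S s -> exists u, u * loc_map s = 1 /\ loc_map s * u = 1;
  loc_frac : forall q, exists s r, S s /\ loc_map s * q = loc_map r;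
  loc_ker : forall r, loc_map r = 0 <-> ass S r }.

(* The assertion that [S^-1 R] exists and has the property [P]. *)
Definition localization_is S (P : pzRingType -> Prop) : Prop :=
  inhabited (left_localization S) /\
  (forall Q : left_localization S, P Q).

End Localization.
Arguments left_regular R : clear implicits.
Arguments regular R : clear implicits.
Arguments max_left_denominator R : clear implicits.

(* The set S_p of the elements of [R] that are regular modulo [p]. *)
Definition regular_mod (R : pzRingType) (p : set R) : set R :=
  [set c | regular (quotient p) (quotient_map p c)].

(* Main.v *)
Require Import Defs.
From HB Require Import structures.
From mathcomp Require Import all_boot all_algebra.
From mathcomp Require Import boolp classical_sets cardinality.

Set Implicit Arguments.
Unset Strict Implicit.
Unset Printing Implicit Defensive.

Import GRing.Theory.

Local Open Scope classical_set_scope.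
Local Open Scope ring_scope.

(** Both directions rest on one construction in a ring [Q] of left fractions of
    [R] with denominators [C]: the extension of a two-sided ideal [J], made of
    the fractions [c^-1 j]. It is always a left ideal, and it is two-sided as
    soon as [Q] is left Artinian, since the chain of the left ideals
    [extension J * d ^+ n] has to stop ([extension_two_sided]). Likewise an
    element of a left Artinian ring that cancels on the right is invertible
    ([left_artinian_left_regular]), so that the elements of [R] regular
    modulo the kernel become invertible in [Q] ([regular_mod_kernel]).

    Suppose that [Q] is semisimple Artinian. Its primes are maximal, finite in
    number and of zero intersection, and each of its ideals is generated by a
    central idempotent. Contraction is then a bijection from the primes [P] of
    [Q] to the minimal primes [p] over [ass C] ([minimal_primes_contraction]),
    the set [S_p] consists of the elements that are invertible modulo [P], and
    [Q / P] is the localization at [S_p]; the central idempotent is what shows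
    that [S_p] kills [p] ([ass_contraction_regular_mod]). A left denominator set
    [T] consists of elements regular modulo [ass T]. When [ass T] is the
    contraction of its extension and this extension is proper, these elements
    become invertible modulo any prime above it, so that [T] lies in some [S_p]
    ([denominator_sub_regular_mod]); conversely the simplicity of [Q / P] leaves
    no room for a left denominator set above [S_p] ([regular_mod_maximal]).

    Suppose instead that the localizations [Q_p] at the [S_p] are simple
    Artinian. Then [R / a] embeds in their product, because a semiprime ideal is
    the intersection of the minimal primes over it
    ([semiprime_bigcap_minimal]). The intersection of the minimal primes other
    than [p] extends to all of the simple ring [Q_p], so it contains an element
    invertible in [Q_p] that vanishes in the other factors
    ([component_unit]). These elements glue denominators of the factors into
    common denominators, regular modulo [a] ([common_denominator]), which density
    replaces by elements of [C]: the product is the localization at [C]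
    ([product_localization]).

    Localizations are unique up to isomorphism ([localization_unique]), and [Q]
    is also the localization of [R / a] at its regular elements
    ([quotient_regular_localization]). Hence what holds for [R] applies to
    [R / a] as well, and the product decompositions are isomorphisms between
    localizations of the same ring at the same set. *)
(** * Ideals and prime ideals *)

Section IdealTheory.
Variable R : pzRingType.
Implicit Types (I J K P X Y : set R) (x y r : R).

Lemma left_ideal0 I : left_ideal I -> I 0. Proof. by case. Qed.

Lemma left_idealD I x y : left_ideal I -> I x -> I y -> I (x + y).
Proof. by case=> _ + _; apply. Qed.

Lemma left_idealM I r x : left_ideal I -> I x -> I (r * x).
Proof. by case=> _ _; apply. Qed.

Lemma left_idealN I x : left_ideal I -> I x -> I (- x).
Proof. by move=> hI Ix; rewrite -mulN1r; apply: left_idealM. Qed.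

Lemma left_idealB I x y : left_ideal I -> I x -> I y -> I (x - y).
Proof. by move=> hI Ix Iy; apply: left_idealD => //; apply: left_idealN. Qed.

Lemma left_ideal1 I : left_ideal I -> I 1 -> I = setT.
Proof.
move=> hI I1; apply/seteqP; split=> // x _.
by rewrite -(mulr1 x); apply: left_idealM.
Qed.

Lemma two_sided_left I : two_sided_ideal I -> left_ideal I.
Proof. by case. Qed.

Lemma two_sidedMr I r x : two_sided_ideal I -> I x -> I (x * r).
Proof. by case=> _; apply. Qed.

Lemma prime_two_sided P : prime_ideal P -> two_sided_ideal P.
Proof. by case. Qed.

Lemma prime_not1 P : prime_ideal P -> ~ P 1.
Proof.
by case=> /two_sided_left hP /eqP nT _ P1; apply: nT; apply: left_ideal1.
Qed.

Definition ideal_sum J K : set R :=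
  [set z | exists x y, [/\ J x, K y & z = x + y]].

Lemma ideal_sum_two_sided J K :
  two_sided_ideal J -> two_sided_ideal K -> two_sided_ideal (ideal_sum J K).
Proof.
move=> hJ hK; have [lJ lK] := (two_sided_left hJ, two_sided_left hK).
split; first split.
- by exists 0, 0; split; rewrite ?addr0 //; apply: left_ideal0.
- move=> _ _ [x [y [Jx Ky ->]]] [x' [y' [Jx' Ky' ->]]].
  by exists (x + x'), (y + y'); split; rewrite 1?addrACA //; apply: left_idealD.
- move=> r _ [x [y [Jx Ky ->]]].
  by exists (r * x), (r * y); split; rewrite 1?mulrDr //; apply: left_idealM.
- move=> r _ [x [y [Jx Ky ->]]].
  by exists (x * r), (y * r); split; rewrite 1?mulrDl //; apply: two_sidedMr.
Qed.

Lemma ideal_suml J K : left_ideal K -> J `<=` ideal_sum J K.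
Proof.
by move=> hK x Jx; exists x, 0; split; rewrite ?addr0 //; apply: left_ideal0.
Qed.

Lemma ideal_sumr J K : left_ideal J -> K `<=` ideal_sum J K.
Proof.
by move=> hJ x Jx; exists 0, x; split; rewrite ?add0r //; apply: left_ideal0.
Qed.

Lemma two_sided_setI J K :
  two_sided_ideal J -> two_sided_ideal K -> two_sided_ideal (J `&` K).
Proof.
move=> hJ hK; have [lJ lK] := (two_sided_left hJ, two_sided_left hK).
split; first split.
- by split; apply: left_ideal0.
- by move=> x y [Jx Kx] [Jy Ky]; split; apply: left_idealD.
- by move=> r x [Jx Kx]; split; apply: left_idealM.
- by move=> r x [Jx Kx]; split; apply: two_sidedMr.
Qed.

Lemma two_sided0 : two_sided_ideal [set 0 : R].
Proof.
by split; first split=> // [x y -> ->|r x ->]; [exact: addr0|exact: mulr0|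
  move=> r x ->; exact: mul0r].
Qed.

(** Residuals turn conditions on products of elements into conditions on
    products of two-sided ideals: they are two-sided when [P] is, for any set [X]
    or [Y], which spares the explicit description of generated ideals. *)
Definition right_residual X P : set R :=
  [set y | forall x r, X x -> P (x * r * y)].

Definition left_residual Y P : set R :=
  [set x | forall y r, Y y -> P (x * r * y)].

Lemma right_residual_two_sided X P :
  two_sided_ideal P -> two_sided_ideal (right_residual X P).
Proof.
move=> hP; have lP := two_sided_left hP; split; first split.
- by move=> x r _; rewrite mulr0; apply: left_ideal0.
- move=> y z hy hz x r Xx; rewrite mulrDr.
  by apply: left_idealD; [exact: lP|exact: hy|exact: hz].
- by move=> s y hy x r Xx; rewrite mulrA -(mulrA x); apply: hy.
- by move=> s y hy x r Xx; rewrite mulrA; apply: two_sidedMr; last exact: hy.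
Qed.

Lemma left_residual_two_sided Y P :
  two_sided_ideal P -> two_sided_ideal (left_residual Y P).
Proof.
move=> hP; have lP := two_sided_left hP; split; first split.
- by move=> y r _; rewrite !mul0r; apply: left_ideal0.
- move=> y z hy hz x r Xx; rewrite !mulrDl.
  by apply: left_idealD; [exact: lP|exact: hy|exact: hz].
- move=> s x hx y r Yy; rewrite -!mulrA; apply: left_idealM => //.
  by rewrite mulrA; apply: hx.
- by move=> s x hx y r Yy; rewrite -(mulrA x); apply: hx.
Qed.

Lemma prime_elements P x y :
  prime_ideal P -> (forall r, P (x * r * y)) -> P x \/ P y.
Proof.
case=> hP _ primeP Pxy.
have := primeP (left_residual (right_residual [set x] P) P)
  (right_residual [set x] P).
case=> [||z w hz hw|sub|sub].
- exact: left_residual_two_sided.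
- exact: right_residual_two_sided.
- by have := hz w 1 hw; rewrite mulr1.
- by left; apply: sub => w r; apply.
- by right; apply: sub => _ r ->.
Qed.

Lemma semiprime_element I x :
  semiprime_ideal I -> (forall r, I (x * r * x)) -> I x.
Proof.
move=> [hI semiI] Ixx; pose K := right_residual [set x] I.
apply: (semiI (left_residual K I `&` K)).
- by apply: two_sided_setI;
    [exact: left_residual_two_sided|exact: right_residual_two_sided].
- by move=> y z [hy _] [_ hz]; have := hy z 1 hz; rewrite mulr1.
- by split=> [w r|_ r ->]; first apply.
Qed.

Lemma two_sided_bigcup (F : set (set R)) :
  F !=set0 -> total_on F subset -> (forall X, F X -> two_sided_ideal X) ->
  two_sided_ideal (\bigcup_(X in F) X).
Proof.
move=> [X0 FX0] totF idF; split; first split.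
- by exists X0 => //; apply: left_ideal0; apply: two_sided_left; apply: idF.
- move=> x y [X FX Xx] [Y FY Yy]; case: (totF X Y FX FY) => sub.
  + exists Y => //; apply: left_idealD => //; last exact: sub.
    by apply: two_sided_left; apply: idF.
  + exists X => //; apply: left_idealD => //; last exact: sub.
    by apply: two_sided_left; apply: idF.
- move=> r x [X FX Xx]; exists X => //.
  by apply: left_idealM => //; apply: two_sided_left; apply: idF.
- by move=> r x [X FX Xx]; exists X => //; apply: two_sidedMr => //; apply: idF.
Qed.

(** Starting from [x] outside the semiprime ideal, one can go on choosing
    [x * r * x] outside it; an ideal maximal among those that avoid the
    resulting sequence is prime, because an ideal containing one term of the
    sequence contains all the later ones. *)
Lemma semiprime_avoiding_prime I x :
  semiprime_ideal I -> ~ I x -> exists P, [/\ prime_ideal P, I `<=` P & ~ P x].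
Proof.
move=> semiI nIx; have hI := semiI.1.
have /choice [g gP] : forall y, exists r, ~ I y -> ~ I (y * r * y).
  move=> y; have [Iy|nIy] := pselect (I y); first by exists 0.
  have [r nIr] : exists r, ~ I (y * r * y).
    by apply/existsNP => all; apply: nIy; apply: semiprime_element.
  by exists r.
pose u n := iter n (fun y => y * g y * y) x.
have nIu n : ~ I (u n) by elim: n => //= n IH; apply: gP.
have uS K m n : two_sided_ideal K -> K (u m) -> K (u (m + n)%N).
  move=> hK Km; elim: n => [|n IH]; first by rewrite addn0.
  by rewrite addnS /=; apply: left_idealM => //; apply: two_sided_left.
pose avoids X := [/\ two_sided_ideal X, I `<=` X & forall n, ~ X (u n)].
(* The empty set is allowed only to bound the empty chain. *)
have [F FP totF|P [PP maxP]] :=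
    @Zorn_bigcup R [set X | X = set0 \/ avoids X].
  pose G := [set X | F X /\ X !=set0].
  have FG : \bigcup_(X in F) X = \bigcup_(X in G) X.
    apply/seteqP; split=> y [X FX Xy]; last by exists X => //; case: FX.
    by exists X => //; split=> //; exists y.
  have [G0|/set0P [X0 GX0]] := eqVneq G set0.
    by left; rewrite FG G0 bigcup_set0.
  have Gav X : G X -> avoids X.
    by case=> /FP [->|//] [y].
  right; rewrite FG; split.
  - apply: two_sided_bigcup; first by exists X0.
    + by move=> X Y [FX _] [FY _]; apply: totF.
    + by move=> X /Gav [].
  - by move=> y Iy; exists X0 => //; have [_ + _] := Gav _ GX0; apply.
  - by move=> n [X /Gav [_ _ nX]]; apply: nX.
have I0 : I 0 by apply: left_ideal0; apply: two_sided_left.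
have {PP}[P0|[hP IP nPu]] := PP.
  have [] := maxP I; last by right; split.
  rewrite P0; split; first exact: sub0set.
  by move=> /(_ 0 I0).
exists P; split=> //; last exact: nPu 0%N.
split=> //.
  by apply/eqP => PT; apply: (nPu 0%N); rewrite PT.
move=> J K hJ hK JKP; apply: contrapT => /not_orP [nJ nK].
have meets L : two_sided_ideal L -> ~ L `<=` P ->
    exists n, ideal_sum L P (u n).
  move=> hL nL; apply: contrapT => /forallNP no.
  have hLP := ideal_sum_two_sided hL hP.
  apply: (maxP (ideal_sum L P)).
    split; first exact: ideal_sumr (two_sided_left hL).
    move=> sub; apply: nL => y Ly; apply: sub.
    exact: ideal_suml (two_sided_left hP) _ Ly.
  right; split=> //; apply: subset_trans IP _.
  exact: ideal_sumr (two_sided_left hL).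
have [m Jm] := meets _ hJ nJ; have [n Kn] := meets _ hK nK.
have := uS _ _ n (ideal_sum_two_sided hJ hP) Jm.
have := uS _ _ m (ideal_sum_two_sided hK hP) Kn; rewrite (addnC n).
move=> [k [p [Kk Pp uE]]] [j [p' [Jj Pp' uE']]].
have lP := two_sided_left hP.
apply: (nPu (m + n).+1); rewrite /= {1}uE' uE mulrDr; apply: left_idealD => //.
  rewrite !mulrDl; apply: left_idealD => //.
    by apply: JKP => //; apply: two_sidedMr.
  by do 2?apply: two_sidedMr.
exact: left_idealM.
Qed.

Lemma prime_bigcap_chain (F : set (set R)) :
  F !=set0 -> total_on F subset -> (forall X, F X -> prime_ideal X) ->
  prime_ideal (\bigcap_(X in F) X).
Proof.
move=> [X0 FX0] totF prF.
have lF X : F X -> left_ideal X by move=> /prF/prime_two_sided/two_sided_left.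
split.
- split; first split.
  + by move=> X /lF; apply: left_ideal0.
  + by move=> x y hx hy X FX; apply: (left_idealD (lF X FX)); [apply: hx|apply: hy].
  + by move=> r x hx X FX; apply: left_idealM; [apply: lF|apply: hx].
  + by move=> r x hx X FX; apply: two_sidedMr; [apply/prime_two_sided/prF|apply: hx].
- apply/eqP => capT; apply: (prime_not1 (prF _ FX0)).
  by have : setT (1 : R) by []; rewrite -capT; apply.
- move=> J K hJ hK JK; apply: contrapT => /not_orP [nJ nK].
  have out L : ~ L `<=` \bigcap_(X in F) X -> exists X, F X /\ ~ L `<=` X.
    move=> nL; apply: contrapT => /forallNP no; apply: nL => y Ly X FX.
    by have /not_andP [//|/contrapT] := no X; apply.
  have [X [FX nX]] := out _ nJ; have [Y [FY nY]] := out _ nK.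
  have [XY|YX] := totF X Y FX FY.
  + have [_ _ primeX] := prF _ FX.
    have [//|sub] := primeX J K hJ hK (fun x y Jx Ky => JK x y Jx Ky X FX).
    by apply: nY; apply: subset_trans sub XY.
  + have [_ _ primeY] := prF _ FY.
    have [sub|//] := primeY J K hJ hK (fun x y Jx Ky => JK x y Jx Ky Y FY).
    by apply: nX; apply: subset_trans sub YX.
Qed.

Lemma minimal_prime_below I P : prime_ideal P -> I `<=` P ->
  exists2 p, minimal_primes I p & p `<=` P.
Proof.
move=> prP IP; pose good X := [/\ prime_ideal X, I `<=` X & X `<=` P].
(* Complements turn the descending chains of primes into ascending ones. *)
have [F FP totF|C [goodC maxC]] :=
    @Zorn_bigcup R [set C | C = set0 \/ good (~` C)].
  pose G := [set X | good X /\ F (~` X)].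
  have [[X0 [FX0 X0n]]|none] := pselect (exists X, F X /\ X !=set0); last first.
    left; apply/seteqP; split=> // y [X FX Xy].
    by apply: none; exists X; split=> //; exists y.
  right.
  have CF : ~` (\bigcup_(X in F) X) = \bigcap_(X in G) X.
    rewrite setC_bigcup; apply/seteqP; split=> y hy.
      by move=> X [_ FX]; exact: contrapT (hy _ FX).
    move=> X FX; have [X_0|gX] := FP X FX; first by rewrite X_0.
    by apply: hy; split=> //; rewrite setCK.
  have GX0 : G (~` X0).
    split; last by rewrite setCK.
    by have [X_0|//] := FP _ FX0; case: X0n => y; rewrite X_0.
  rewrite CF; split.
  - apply: prime_bigcap_chain; first by exists (~` X0).
    + move=> X Y [_ FX] [_ FY].
      have [/subsetC sub|/subsetC sub] := totF _ _ FX FY; [right|left];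
        by rewrite !setCK in sub.
    + by move=> X [[]].
  - by move=> y Iy X [[_ + _] _]; apply.
  - by move=> y hy; have [[_ _ +] _] := GX0; apply; apply: hy.
have {goodC} goodC : good (~` C).
  have [C0|//] := goodC.
  have [] := maxC (~` P); last by right; split; rewrite setCK.
  rewrite C0; split; first exact: sub0set.
  by move=> /(_ 1); apply; exact: prime_not1 prP.
have [prC IC CP] := goodC; exists (~` C) => //; split=> // P' prP' IP' P'C.
apply/seteqP; split=> // y nCy; apply: contrapT => nP'y.
apply: (maxC (~` P')); last first.
  by right; split; rewrite setCK //; apply: subset_trans CP.
split; first by rewrite -(setCK C); apply: subsetC.
by move=> /(_ y nP'y).
Qed.

Lemma semiprime_bigcap_minimal I x :
  semiprime_ideal I -> (forall p, minimal_primes I p -> p x) -> I x.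
Proof.
move=> semiI Ix; apply: contrapT => nIx.
have [P [prP IP nPx]] := semiprime_avoiding_prime semiI nIx.
have [p minp pP] := minimal_prime_below prP IP.
by apply: nPx; apply: pP; apply: Ix.
Qed.

End IdealTheory.

Lemma two_sided_preimage (A B : pzRingType) (f : {rmorphism A -> B}) (J : set B) :
  two_sided_ideal J -> two_sided_ideal (f @^-1` J).
Proof.
move=> hJ; have lJ := two_sided_left hJ; split; first split.
- by rewrite /preimage /= rmorph0; apply: left_ideal0.
- by move=> x y; rewrite /preimage /= rmorphD; apply: left_idealD.
- by move=> r x; rewrite /preimage /= rmorphM; apply: left_idealM.
- by move=> r x; rewrite /preimage /= rmorphM; apply: two_sidedMr.
Qed.

(** * Artinian and semisimple rings *)

Definition invertible (A : pzRingType) (x : A) : Prop :=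
  exists u, u * x = 1 /\ x * u = 1.

Section RingTransport.

(** The morphism is kept unbundled so that the lemma also applies to the
    converse rings. *)
Lemma left_artinian_image (A B : pzRingType) (f : A -> B) :
  {morph f : x y / x + y} -> {morph f : x y / x * y} ->
  (forall b, exists a, f a = b) -> left_artinian A -> left_artinian B.
Proof.
move=> fD fM fS artA J hJ dJ.
have f0 : f 0 = 0 by apply: (@addrI _ (f 0)); rewrite -fD !addr0.
have [n|n x Jx|n Jn] := artA (fun n => f @^-1` (J n)).
- split.
  + by rewrite /preimage /= f0; apply: left_ideal0.
  + by move=> x y; rewrite /preimage /= fD; apply: left_idealD.
  + by move=> r x; rewrite /preimage /= fM; apply: left_idealM.
- exact: dJ Jx.
exists n => m nm; apply/seteqP; split=> b; have [a <-] := fS b.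
  by have -> : J m (f a) = (f @^-1` J m) a by []; rewrite Jn.
by have -> : J n (f a) = (f @^-1` J n) a by []; rewrite -(Jn m).
Qed.

Variables (A B : pzRingType) (f : {rmorphism A -> B}).
Hypothesis f_surj : forall b, exists a, f a = b.

Lemma artinian_image : artinian A -> artinian B.
Proof.
case=> artA artAc; split.
  exact: (left_artinian_image (rmorphD f) (rmorphM f) f_surj artA).
apply: (@left_artinian_image A^c B^c f) => // [x y|x y].
  exact: (rmorphD f).
exact: (rmorphM f y x).
Qed.

End RingTransport.

Lemma semisimpleP (A : pzRingType) : semisimple A <->
  (forall L : set A, left_ideal L ->
    (forall M, minimal_left_ideal M -> M `<=` L) -> L = setT).
Proof.
split=> [ssA L hL ML|all].
  apply/seteqP; split=> // x _.
  have : setT x by []; rewrite -ssA; apply; split=> // y [M minM My].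
  exact: ML My.
apply/seteqP; split=> // x _ L [hL ML]; rewrite (all L) // => M minM y My.
by apply: ML; exists M.
Qed.

Lemma minimal_left_ideal_left (A : pzRingType) (M : set A) :
  minimal_left_ideal M -> left_ideal M.
Proof. by case. Qed.

(** A map that carries left ideals back and forth sends a minimal left ideal to
    zero or to a minimal left ideal, as for modules. *)
Lemma minimal_left_ideal_image (A B : pzRingType) (f : A -> B) (M : set A) :
  f 0 = 0 -> (forall J, left_ideal J -> left_ideal (f @^-1` J)) ->
  left_ideal (f @` M) -> minimal_left_ideal M ->
  f @` M = [set 0] \/ minimal_left_ideal (f @` M).
Proof.
move=> f0 preJ hfM [hM _ smallM].
have [fM0|fMn0] := pselect (f @` M = [set 0]); [by left|right].
split=> // J hJ JfM.
have hMJ : left_ideal (M `&` f @^-1` J).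
  have hJ' := preJ J hJ; split; first by split; apply: left_ideal0.
    by move=> x y [Mx Jx] [My Jy]; split; apply: left_idealD.
  by move=> r x [Mx Jx]; split; apply: left_idealM.
have [|MJ0|MJ] := smallM _ hMJ; first by apply: subIsetl.
  left; apply/seteqP; split=> [b Jb|_ ->]; last exact: left_ideal0.
  have [m Mm fm] := JfM _ Jb.
  have /= m0 : [set 0] m by rewrite -MJ0; split=> //; rewrite /preimage /= fm.
  by rewrite -fm m0 f0.
right; apply/seteqP; split=> // _ [m Mm <-].
by have [] : (M `&` f @^-1` J) m by rewrite MJ.
Qed.

Lemma semisimple_image (A B : pzRingType) (f : {rmorphism A -> B}) :
  (forall b, exists a, f a = b) -> semisimple A -> semisimple B.
Proof.
move=> fS /semisimpleP ssA; apply/semisimpleP => L hL ML.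
have preJ J : left_ideal J -> left_ideal (f @^-1` J).
  move=> hJ; split; rewrite /preimage /=.
  - by rewrite rmorph0; apply: left_ideal0.
  - by move=> x y; rewrite rmorphD; apply: left_idealD.
  - by move=> r x; rewrite rmorphM; apply: left_idealM.
apply: left_ideal1 => //; rewrite -(rmorph1 f).
suff : (f @^-1` L) 1 by [].
rewrite (ssA _ (preJ L hL)) // => M minM.
have hM := minimal_left_ideal_left minM.
have hfM : left_ideal (f @` M).
  split.
  - by exists 0; [exact: left_ideal0|rewrite rmorph0].
  - move=> _ _ [x Mx <-] [y My <-].
    by exists (x + y); [exact: left_idealD|rewrite rmorphD].
  - move=> r _ [x Mx <-]; have [a <-] := fS r.
    by exists (a * x); [exact: left_idealM|rewrite rmorphM].
have [fM0|minfM] := minimal_left_ideal_image (rmorph0 f) preJ hfM minM.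
  move=> m Mm; rewrite /preimage /=.
  have /= -> : [set 0] (f m) by rewrite -fM0; exists m.
  exact: left_ideal0.
by move=> m Mm; apply: (ML _ minfM); exists m.
Qed.

Lemma simple_ring_iso (A B : pzRingType) (f : {rmorphism A -> B}) :
  bijective f -> simple_ring A -> simple_ring B.
Proof.
move=> bijf [n10 simA]; have [g fK gK] := bijf; split.
  by rewrite -(rmorph1 f) -(rmorph0 f) => /(can_inj fK).
move=> J hJ; have [J0|JT] := simA _ (two_sided_preimage f hJ).
  left; apply/seteqP; split=> [b Jb|_ ->].
    have /= gb0 : [set 0] (g b) by rewrite -J0 /preimage /= gK.
    by rewrite /= -(gK b) gb0 rmorph0.
  exact: left_ideal0 (two_sided_left hJ).
right; apply/seteqP; split=> // b _; rewrite -(gK b).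
by have : setT (g b) by []; rewrite -JT.
Qed.

Lemma bijective_surj T U (f : T -> U) : bijective f -> forall b, exists a, f a = b.
Proof. by case=> g _ gK b; exists (g b). Qed.

Lemma simple_artinian_iso (A B : pzRingType) :
  ring_iso A B -> simple_artinian A -> simple_artinian B.
Proof.
case=> f bijf [simA artA]; split; first exact: simple_ring_iso bijf simA.
exact: artinian_image (bijective_surj bijf) artA.
Qed.

Lemma semisimple_artinian_iso (A B : pzRingType) :
  ring_iso A B -> semisimple_artinian A -> semisimple_artinian B.
Proof.
case=> f bijf [ssA artA]; have fS := bijective_surj bijf.
by split; [exact: (semisimple_image fS ssA)|exact: artinian_image fS artA].
Qed.

Section RingIso.
Variables A B C : pzRingType.

Lemma ring_iso_intro (f : A -> B) :
  zmod_morphism f -> monoid_morphism f -> bijective f -> ring_iso A B.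
Proof.
move=> fB fM bijf.
pose fA := GRing.isZmodMorphism.Build A B f fB.
pose fR := GRing.isMonoidMorphism.Build A B f fM.
pose g : {rmorphism A -> B} := HB.pack f fA fR.
by exists g.
Qed.

Lemma ring_iso_trans : ring_iso A B -> ring_iso B C -> ring_iso A C.
Proof. by case=> f bf [g bg]; exists (g \o f); apply: bij_comp. Qed.

End RingIso.

Lemma ring_iso_sym (A B : pzRingType) : ring_iso A B -> ring_iso B A.
Proof.
case=> f [g fK gK]; apply: (@ring_iso_intro _ _ g); last by exists f.
  exact: can2_zmod_morphism.
exact: can2_monoid_morphism.
Qed.

(** The chain of the left ideals [A * c ^+ n] stops, so that
    [c ^+ n = x * c ^+ n.+1] for some [x], and [c] cancels on the right. *)
Lemma left_artinian_left_regular (A : pzRingType) (c : A) :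
  left_artinian A -> left_regular A c -> invertible c.
Proof.
move=> artA regc; pose J n := [set y | exists x, y = x * c ^+ n].
have hJ n : left_ideal (J n).
  split; first by exists 0; rewrite mul0r.
    by move=> _ _ [x ->] [y ->]; exists (x + y); rewrite mulrDl.
  by move=> r _ [x ->]; exists (r * x); rewrite mulrA.
have dJ n : J n.+1 `<=` J n.
  by move=> _ [x ->]; exists (x * c); rewrite exprS mulrA.
have [n /(_ _ (leqnSn n)) Jn] := artA J hJ dJ.
have [x cn] : J n.+1 (c ^+ n) by rewrite Jn; exists 1; rewrite mul1r.
have cancel_pow m y : y * c ^+ m = 0 -> y = 0.
  elim: m y => [|m IH] y; first by rewrite expr0 mulr1.
  by rewrite exprS mulrA => /IH /regc.
have xc : x * c = 1.
  apply/eqP; rewrite -subr_eq0; apply/eqP; apply: (cancel_pow n).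
  by rewrite mulrBl mul1r -mulrA -exprS -cn subrr.
exists x; split=> //; apply/eqP; rewrite -subr_eq0; apply/eqP; apply: regc.
by rewrite mulrBl mul1r -mulrA xc mulr1 subrr.
Qed.

Lemma left_artinian_minimal_left_ideal (A : pzRingType) :
  left_artinian A -> (1 : A) <> 0 -> exists M : set A, minimal_left_ideal M.
Proof.
move=> artA n10; apply: contrapT => /forallNP none.
pose nontriv (I : set A) := left_ideal I /\ I <> [set 0].
have /choice [g gP] : forall I, exists J,
    nontriv I -> [/\ nontriv J, J `<=` I & J <> I].
  move=> I; have [[hI I0]|no] := pselect (nontriv I); last by exists I.
  apply: contrapT => /forallNP noJ; apply: (none I); split=> // J hJ JI.
  have /not_implyP [_ bad] := noJ J.
  by apply: contrapT => /not_orP [J0 JnI]; apply: bad.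
pose J n := iter n g setT.
have nJ n : nontriv (J n).
  elim: n => [|n /gP [] //]; split=> // T0; apply: n10.
  by rewrite -[_ = _]/([set 0] (1 : A)) -T0.
have [n|n|n /(_ _ (leqnSn n)) Jn] := artA J; first by case: (nJ n).
  by case: (gP _ (nJ n)).
by case: (gP _ (nJ n)).
Qed.

(** The socle is two-sided, because [M * r] is zero or minimal when [M] is
    minimal. *)
Lemma simple_left_artinian_semisimple (A : pzRingType) :
  simple_ring A -> left_artinian A -> semisimple A.
Proof.
move=> [n10 simA] artA; have [M0 minM0] := left_artinian_minimal_left_ideal artA n10.
pose socle := smallest (@left_ideal A) (\bigcup_(M in @minimal_left_ideal A) M).
have hsocle : left_ideal socle.
  split; first by move=> L [hL _]; apply: left_ideal0.
    by move=> x y hx hy L CL; apply: left_idealD; [case: CL|apply: hx|apply: hy].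
  by move=> r x hx L CL; apply: left_idealM; [case: CL|apply: hx].
have min_socle M : minimal_left_ideal M -> M `<=` socle.
  by move=> minM m Mm L [_]; apply; exists M.
have [|socle0|//] := simA socle.
  split=> // r x hx L [hL ML].
  have preJ J : left_ideal J -> left_ideal ((fun y => y * r) @^-1` J).
    move=> hJ; split; rewrite /preimage /=.
    - by rewrite mul0r; apply: left_ideal0.
    - by move=> y z; rewrite mulrDl; apply: left_idealD.
    - by move=> s y; rewrite -mulrA; apply: left_idealM.
  apply: (hx ((fun y => y * r) @^-1` L)); split=> [|m [M minM Mm]]; first exact: preJ.
  have hM := minimal_left_ideal_left minM.
  have hMr : left_ideal ((fun y => y * r) @` M).
    split; first by exists 0; [exact: left_ideal0|exact: mul0r].
      move=> _ _ [y My <-] [z Mz <-].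
      by exists (y + z); [exact: left_idealD|exact: mulrDl].
    by move=> s _ [y My <-]; exists (s * y); [exact: left_idealM|rewrite mulrA].
  have [Mr0|minMr] := minimal_left_ideal_image (mul0r r) preJ hMr minM.
    have /= mr0 : [set 0] (m * r) by rewrite -Mr0; exists m.
    by rewrite /preimage /= mr0; apply: left_ideal0.
  by apply: ML; exists [set y * r | y in M] => //; exists m.
have [hM0 nM0 _] := minM0; case: nM0; apply/seteqP; split=> [m M0m|_ ->].
  by rewrite -socle0; apply: min_socle M0m.
exact: left_ideal0.
Qed.

(** * Two-sided ideals of a semisimple ring *)

Lemma minimal_mul (A : pzRingType) (M J : set A) x :
  minimal_left_ideal M -> left_ideal J -> M x ->
  (forall j, J j -> j * x = 0) \/ (forall y, M y -> exists2 j, J j & y = j * x).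
Proof.
move=> [hM _ minM] hJ Mx; have [||Jx0|JxM] := minM [set j * x | j in J].
- split; first by exists 0; [exact: left_ideal0|exact: mul0r].
  + move=> _ _ [j Jj <-] [k Jk <-].
    by exists (j + k); [exact: left_idealD|rewrite mulrDl].
  + by move=> r _ [j Jj <-]; exists (r * j); [exact: left_idealM|rewrite mulrA].
- by move=> _ [j Jj <-]; apply: left_idealM.
- by left=> j Jj; rewrite -[_ = _]/([set 0] (j * x)) -Jx0; exists j.
- by right=> y; rewrite -JxM => -[j Jj <-]; exists j.
Qed.

Lemma minimal_left_ideal_split (A : pzRingType) (M J : set A) :
  minimal_left_ideal M -> two_sided_ideal J ->
  M `<=` J \/ (forall j m, J j -> M m -> j * m = 0).
Proof.
move=> minM hJ; have [MJ|nMJ] := pselect (M `<=` J); [by left|right].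
move=> j m Jj Mm; have [|JmM] := minimal_mul minM (two_sided_left hJ) Mm.
  by apply.
case: nMJ => y /JmM [k Jk ->]; exact: two_sidedMr.
Qed.

(** If [K] does not annihilate [M], then [K * m = M] for some [m] in [M], so that
    [J] annihilates [M] whenever [J * K] does. These primes separate the points of
    a semisimple ring. *)
Lemma annihilator_prime (A : pzRingType) (M : set A) :
  minimal_left_ideal M -> prime_ideal (left_residual M [set 0]).
Proof.
move=> minM; have [hM nM0 _] := minM; split.
- exact: left_residual_two_sided (two_sided0 A).
- apply/eqP => annT; apply: nM0; apply/seteqP; split=> [m Mm|_ ->].
    have : left_residual M [set 0] 1 by rewrite annT.
    by move=> /(_ m 1 Mm); rewrite !mul1r.
  exact: left_ideal0.
- move=> J K hJ hK JK; apply: contrapT => /not_orP[nJ nK]; apply: nK => k Kk m r Mm.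
  apply: contrapT => /= nz; apply: nJ => j Jj m' r' Mm'.
  have Mrm : M (r * m) by apply: left_idealM.
  have [Krm|KM] := minimal_mul minM (two_sided_left hK) Mrm.
    by case: nz; rewrite -mulrA Krm.
  have [|k' Kk' E] := KM (r' * m'); first exact: left_idealM.
  by rewrite -mulrA E mulrA (mulrA (j * k')); exact: JK.
Qed.

Section SemisimpleIdeals.
Variables (A : pzRingType) (ssA : semisimple A).
Implicit Types (J K L M P : set A).

Let ssAP L : left_ideal L -> (forall M, minimal_left_ideal M -> M `<=` L) ->
  forall x, L x.
Proof. by move=> hL ML x; move/semisimpleP: ssA => /(_ L hL ML) ->. Qed.

Lemma semisimple_square0 J : two_sided_ideal J ->
  (forall x y, J x -> J y -> x * y = 0) -> forall x, J x -> x = 0.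
Proof.
move=> hJ JJ x Jx; have lJ := two_sided_left hJ.
suff : right_residual J [set 0] 1 by move=> /(_ x 1 Jx); rewrite !mulr1.
apply: (ssAP (two_sided_left (right_residual_two_sided _ (two_sided0 A)))).
move=> M minM m Mm j r Jj; have Jjr : J (j * r) by apply: two_sidedMr.
have [/(_ _ Jjr) //|JM] := minimal_mul minM lJ Mm.
have [k Jk mE] := JM m Mm.
by rewrite /= mE mulrA (JJ (j * r) k) ?mul0r.
Qed.

(** Each minimal left ideal lies in [J] or is killed by [J], so that
    [1 = e + f] with [e] in [J] and [f] killed by [J]. *)
Lemma semisimple_ideal_unit J : two_sided_ideal J -> exists e, [/\ J e,
  (forall j, J j -> e * j = j /\ j * e = j) & forall x, e * x = x * e].
Proof.
move=> hJ; have lJ := two_sided_left hJ; pose K := right_residual J [set 0].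
have hK : two_sided_ideal K by apply: right_residual_two_sided (two_sided0 A).
have : ideal_sum J K 1.
  apply: (ssAP (two_sided_left (ideal_sum_two_sided hJ hK))).
  move=> M minM; have [MJ|JM0] := minimal_left_ideal_split minM hJ.
    exact: subset_trans MJ (ideal_suml (two_sided_left hK)).
  apply: subset_trans (ideal_sumr lJ) => m Mm j r Jj.
  by apply: JM0 => //; apply: two_sidedMr.
move=> [e [f [Je Kf ef]]].
have JK0 j k : J j -> K k -> j * k = 0.
  by move=> Jj Kk; have := Kk j 1 Jj; rewrite mulr1.
have JIK x : (J `&` K) x -> x = 0.
  apply: (semisimple_square0 (two_sided_setI hJ hK)).
  by move=> y z [Jy _] [_ Kz]; apply: JK0.
have unit_e j : J j -> e * j = j /\ j * e = j.
  move=> Jj; split; last by rewrite -[RHS]mulr1 ef mulrDr (JK0 j f) // addr0.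
  rewrite -[RHS]mul1r ef mulrDl (JIK (f * j)) ?addr0 //.
  by split; [exact: left_idealM|exact: two_sidedMr hK Kf].
exists e; split=> // x.
have [_ <-] := unit_e (e * x) (two_sidedMr x hJ Je).
have [<- _] := unit_e (x * e) (left_idealM x lJ Je).
by rewrite mulrA.
Qed.

Lemma prime_above_proper J : two_sided_ideal J -> J != setT ->
  exists2 P, prime_ideal P & J `<=` P.
Proof.
move=> hJ /eqP nJT.
have [M [minM nMJ]] : exists M, minimal_left_ideal M /\ ~ M `<=` J.
  apply: contrapT => /forallNP no; apply: nJT; apply/seteqP; split=> // x _.
  apply: (ssAP (two_sided_left hJ)) => M minM.
  by have /not_andP [//|/contrapT] := no M.
exists (left_residual M [set 0]); first exact: annihilator_prime.
move=> j Jj m r Mm; have [//|JM0] := minimal_left_ideal_split minM hJ.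
by apply: JM0 => //; apply: two_sidedMr.
Qed.

Lemma semisimple_primes_separate x : (forall P, prime_ideal P -> P x) -> x = 0.
Proof.
move=> Px; suff : right_residual [set x] [set 0] 1.
  by move=> /(_ x 1 erefl); rewrite !mulr1.
apply: (ssAP (two_sided_left (right_residual_two_sided _ (two_sided0 A)))).
move=> M minM m Mm _ r ->.
by have := Px _ (annihilator_prime minM) m r Mm.
Qed.

Lemma prime_comaximal P J : prime_ideal P -> two_sided_ideal J ->
  ~ J `<=` P -> forall x, ideal_sum J P x.
Proof.
move=> prP hJ nJP; have hP := prime_two_sided prP.
apply: (ssAP (two_sided_left (ideal_sum_two_sided hJ hP))).
move=> M minM; have [MJ|JM0] := minimal_left_ideal_split minM hJ.
  exact: subset_trans MJ (ideal_suml (two_sided_left hP)).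
apply: subset_trans (ideal_sumr (two_sided_left hJ)).
have [_ _ primeP] := prP.
have [||x y Jx Ky|//|KP] := primeP J (right_residual J P) => //.
- exact: right_residual_two_sided.
- by have := Ky x 1 Jx; rewrite mulr1.
- move=> m Mm; apply: KP => j r Jj; rewrite JM0 //; last exact: two_sidedMr.
  exact: left_ideal0 (two_sided_left hP).
Qed.

Lemma semisimple_prime_maximal P J : prime_ideal P -> two_sided_ideal J ->
  J != setT -> P `<=` J -> J = P.
Proof.
move=> prP hJ /eqP nJT PJ; apply/seteqP; split=> //; apply: contrapT => nJP.
apply: nJT; apply: left_ideal1; first exact: two_sided_left.
have [x [y [Jx Py ->]]] := prime_comaximal prP hJ nJP 1.
by apply: left_idealD => //; [exact: two_sided_left|exact: PJ].
Qed.

Lemma semisimple_prime_incl P P' : prime_ideal P -> prime_ideal P' ->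
  P `<=` P' -> P' = P.
Proof.
move=> prP prP'; apply: semisimple_prime_maximal => //; first exact: prime_two_sided.
by case: prP'.
Qed.

End SemisimpleIdeals.

Lemma prime_contains_factor (R : pzRingType) (P : set R) (s : seq (set R)) :
  prime_ideal P -> (forall I, I \in s -> two_sided_ideal I) ->
  (forall x, (forall I, I \in s -> I x) -> P x) -> exists2 I, I \in s & I `<=` P.
Proof.
move=> prP; elim: s => [|I s IH] hs sP.
  by case: (prime_not1 prP); apply: sP => I; rewrite in_nil.
have [IP|nIP] := pselect (I `<=` P); first by exists I; rewrite ?mem_head.
have hI : two_sided_ideal I by apply: hs; rewrite mem_head.
have [||K Ks KP] := IH; last by exists K; rewrite // inE Ks orbT.
  by move=> K Ks; apply: hs; rewrite inE Ks orbT.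
move=> y Ky; have /existsNP [x /not_implyP [Ix nPx]] := nIP.
have [r|//|//] := @prime_elements _ P x y prP.
apply: sP => K; rewrite inE => /predU1P [->|Ks].
  by do 2?apply: two_sidedMr.
have hK : two_sided_ideal K by apply: hs; rewrite inE Ks orbT.
by apply: left_idealM; [exact: two_sided_left|exact: Ky].
Qed.

(** The partial intersections of a sequence of distinct primes would form a
    descending chain that does not stop. *)
Lemma semisimple_artinian_primes_finite (A : pzRingType) :
  semisimple A -> left_artinian A -> finite_set [set P : set A | prime_ideal P].
Proof.
move=> ssA artA; apply: contrapT => /infiniteP/pcard_leP/injfunPex[u u_prime u_inj].
have pru n : prime_ideal (u n) by apply: u_prime.
have hu n := prime_two_sided (pru n).
have lu n := two_sided_left (hu n).
have [n|n x Jx i lin|n /(_ _ (leqnSn n)) Jn] :=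
    artA (fun n => [set x | forall i, (i < n)%N -> u i x]).
- split; first by move=> i _; apply: left_ideal0.
  + by move=> x y hx hy i lin; apply: left_idealD; [|apply: hx|apply: hy].
  + by move=> r x hx i lin; apply: left_idealM; [|apply: hx].
- by apply: Jx; apply: ltnW.
have [I|x hx|_ /mapP [i + ->] uin] :=
    @prime_contains_factor _ (u n) [seq u i | i <- iota 0 n] (pru n).
- by case/mapP => i _ ->.
- have : [set x | forall i, (i < n)%N -> u i x] x.
    by move=> i lin; apply: hx; apply: map_f; rewrite mem_iota.
  by rewrite -Jn; apply.
rewrite mem_iota /= add0n => lin.
have : u n = u i by apply: semisimple_prime_incl uin.
move=> /u_inj E; rewrite -E ?in_setT // in lin.
by rewrite ltnn in lin.
Qed.

(** * Invertible elements and regular elements modulo an ideal *)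

Section Invertible.
Variable A : pzRingType.
Implicit Types x y : A.

Lemma invertible1 : invertible (1 : A).
Proof. by exists 1; rewrite mulr1. Qed.

Lemma invertibleM x y : invertible x -> invertible y -> invertible (x * y).
Proof.
move=> [u [ux xu]] [v [vy yv]]; exists (v * u); split.
  by rewrite mulrA -(mulrA v) ux mulr1.
by rewrite mulrA -(mulrA x) yv mulr1.
Qed.

Lemma invertible_mul0 x y : invertible x -> x * y = 0 -> y = 0.
Proof. by case=> u [ux _] xy; rewrite -(mul1r y) -ux -mulrA xy mulr0. Qed.

Lemma invertible_mul0r x y : invertible x -> y * x = 0 -> y = 0.
Proof. by case=> u [_ xu] yx; rewrite -(mulr1 y) -xu mulrA yx mul0r. Qed.

Lemma invertible_left_ideal (J : set A) x y :
  left_ideal J -> invertible x -> J (x * y) -> J y.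
Proof.
by move=> hJ [u [ux _]] Jxy; rewrite -(mul1r y) -ux -mulrA; apply: left_idealM.
Qed.

Lemma invertible_morph (B : pzRingType) (f : {rmorphism A -> B}) x :
  invertible x -> invertible (f x).
Proof.
by case=> u [ux xu]; exists (f u); rewrite -!rmorphM ux xu rmorph1.
Qed.

End Invertible.

Section QuotientMap.
Variables (R : pzRingType) (I : set R).
Hypothesis hI : two_sided_ideal I.

Lemma quotient_map0 x : quotient_map I x = 0 <-> I x.
Proof. by rewrite quotient_map_eq0 ideal_gen_id. Qed.

Lemma regular_modP c : regular_mod I c <->
  (forall x, I (x * c) -> I x) /\ (forall x, I (c * x) -> I x).
Proof.
rewrite /regular_mod /regular /=; split=> -[regl regr]; split=> x.
- by move=> Ixc; apply/quotient_map0/regl; rewrite -rmorphM; apply/quotient_map0.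
- by move=> Icx; apply/quotient_map0/regr; rewrite -rmorphM; apply/quotient_map0.
- have [y <-] := quotient_map_surj x.
  by rewrite -rmorphM => /quotient_map0/regl/quotient_map0.
- have [y <-] := quotient_map_surj x.
  by rewrite -rmorphM => /quotient_map0/regr/quotient_map0.
Qed.

Lemma quotient_invertible x u :
  I (u * x - 1) -> I (x * u - 1) -> invertible (quotient_map I x).
Proof.
move=> ux xu; exists (quotient_map I u).
by split; rewrite -rmorphM -(rmorph1 (quotient_map I)); apply/quotient_map_eq;
  rewrite ideal_gen_id.
Qed.

End QuotientMap.

(** In an artinian ring of left fractions, regularity modulo the kernel amounts
    to invertibility: a right factor that cancels modulo the kernel still
    cancels in the ring of fractions, where it has to be invertible. *)
Lemma regular_mod_kernel (R A : pzRingType) (f : {rmorphism R -> A}) (p : set R) c :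
  left_artinian A -> two_sided_ideal p -> (forall r, f r = 0 <-> p r) ->
  (forall q, exists s r, invertible (f s) /\ f s * q = f r) ->
  regular_mod p c <-> invertible (f c).
Proof.
move=> artA hp kerf fracf; split=> [/(regular_modP hp) [regl _]|invc].
  apply: left_artinian_left_regular => // q qc0.
  have [s [r [invs sq]]] := fracf q; apply: (invertible_mul0 invs).
  by rewrite sq; apply/kerf/regl/kerf; rewrite rmorphM -sq -mulrA qc0 mulr0.
apply/(regular_modP hp); split=> x /kerf; rewrite rmorphM.
  by move=> /(invertible_mul0r invc)/kerf.
by move=> /(invertible_mul0 invc)/kerf.
Qed.

(** * Left localizations *)

Section Denominators.
Variables (R : pzRingType) (S : set R).

Lemma ass_two_sided : left_ore S -> two_sided_ideal (ass S).
Proof.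
move=> [[S1 SM S0] ore]; split; first split.
- by exists 1; rewrite ?mulr0.
- move=> x y [s Ss sx] [t St ty]; have [u [v [Su us]]] := ore s t St.
  exists (u * s); first exact: SM.
  by rewrite mulrDr -mulrA sx mulr0 us -mulrA ty mulr0 addr0.
- move=> r x [s Ss sx]; have [u [v [Su ur]]] := ore r s Ss.
  by exists u; rewrite // mulrA ur -mulrA sx mulr0.
- by move=> r x [s Ss sx]; exists s; rewrite // mulrA sx mul0r.
Qed.

Lemma multiplicative_ass s : multiplicative_set S -> S s -> ~ ass S s.
Proof. by move=> [_ SM S0] Ss [t St ts]; apply: S0; rewrite -ts; apply: SM. Qed.

(** If [t * x * s = 0] with [t] in [S], the denominator condition moves [s] to the
    left of [t * x]; a product [s * x] needs only that [S] is multiplicative. *)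
Lemma denominator_regular_mod s :
  left_denominator S -> S s -> regular_mod (ass S) s.
Proof.
move=> [oreS denS] Ss; have [[S1 SM S0] _] := oreS.
apply/(regular_modP (ass_two_sided oreS)); split=> x [t St].
  rewrite mulrA => /(denS _ _ Ss) [u Su utx].
  by exists (u * t); [exact: SM|rewrite -mulrA].
by rewrite mulrA => tsx; exists (t * s); first exact: SM.
Qed.

(** A ring in which [S] becomes invertible, all of whose elements are left
    fractions and with kernel [ass S], is a left localization: the Ore
    condition can be read off it. *)
Lemma localization_intro (A : pzRingType) (f : {rmorphism R -> A}) :
  multiplicative_set S -> (forall s, S s -> invertible (f s)) ->
  (forall q, exists s r, S s /\ f s * q = f r) ->
  (forall r, f r = 0 <-> ass S r) ->
  exists L : left_localization S, ring_iso A L.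
Proof.
move=> mulS inv frac ker.
have den : left_denominator S.
  split; first split=> //.
    move=> r s Ss; have [u [us su]] := inv s Ss.
    have [t [x [St tE]]] := frac (f r * u).
    have [w Sw w0] : ass S (t * r - x * s).
      by apply/ker; rewrite rmorphB !rmorphM -tE -!mulrA us mulr1 subrr.
    exists (w * t), (w * x); split; first by case: mulS => _ + _; apply.
    by apply/eqP; rewrite -subr_eq0 -!mulrA -mulrBr w0.
  move=> r s Ss rs0; apply/ker; apply: (invertible_mul0r (inv s Ss)).
  by rewrite -rmorphM rs0 rmorph0.
exists (LeftLocalization den inv frac ker).
by exists idfun; exists idfun.
Qed.

End Denominators.

Section LocalizationUnique.
Variables (R : pzRingType) (S : set R).

Definition same_fraction (L1 L2 : left_localization S) (x : L1) (y : L2) : Prop :=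
  exists s r, [/\ S s, loc_map L1 s * x = loc_map L1 r
                & loc_map L2 s * y = loc_map L2 r].

Section TwoLocalizations.
Variables L1 L2 : left_localization S.
Let den := loc_denominator L1.
Let ore r s : S s -> exists t x, S t /\ t * r = x * s.
Proof. by move=> Ss; apply: den.1.2. Qed.
Let SM s t : S s -> S t -> S (s * t).
Proof. by case: den => -[[_ + _] _] _; apply. Qed.

Let same_fraction_total (x : L1) : exists y : L2, same_fraction x y.
Proof.
have [s [r [Ss sx]]] := loc_frac x; have [u [us su]] := loc_inv L2 Ss.
by exists (u * loc_map L2 r), s, r; split=> //; rewrite mulrA su mul1r.
Qed.

Let same_fractionB (x x' : L1) (y y' : L2) :
  same_fraction x y -> same_fraction x' y' -> same_fraction (x - x') (y - y').
Proof.
move=> [s [r [Ss sx sy]]] [s' [r' [Ss' sx' sy']]].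
have [t [z [St tz]]] := ore s Ss'; exists (t * s), (t * r - z * r'); split.
- exact: SM.
- by rewrite mulrBr {2}tz !rmorphM -!mulrA sx sx' rmorphB !rmorphM.
- by rewrite mulrBr {2}tz !rmorphM -!mulrA sy sy' rmorphB !rmorphM.
Qed.

Let same_fractionM (x x' : L1) (y y' : L2) :
  same_fraction x y -> same_fraction x' y' -> same_fraction (x * x') (y * y').
Proof.
move=> [s [r [Ss sx sy]]] [s' [r' [Ss' sx' sy']]].
have [t [z [St tz]]] := ore r Ss'; exists (t * s), (z * r'); split.
- exact: SM.
- by rewrite mulrA rmorphM -(mulrA (loc_map L1 t)) sx -rmorphM tz !rmorphM -mulrA sx'.
- by rewrite mulrA rmorphM -(mulrA (loc_map L2 t)) sy -rmorphM tz !rmorphM -mulrA sy'.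
Qed.

Let same_fraction1 : @same_fraction L1 L2 1 1.
Proof. by exists 1, 1; split; rewrite ?mulr1 //; case: den => -[[]]. Qed.

Lemma same_fraction_unique (x : L1) (y y' : L2) :
  same_fraction x y -> same_fraction x y' -> y = y'.
Proof.
move=> xy xy'; have := same_fractionB xy xy'; rewrite subrr => -[s [r [Ss]]].
rewrite mulr0 => /esym/loc_ker/(loc_ker L2) -> sy.
apply/eqP; rewrite -subr_eq0; apply/eqP.
exact: invertible_mul0 (loc_inv L2 Ss) sy.
Qed.

Lemma same_fraction_morphism : exists f : L1 -> L2,
  [/\ zmod_morphism f, monoid_morphism f & forall x, same_fraction x (f x)].
Proof.
have [f fP] := choice same_fraction_total; exists f; split=> //.
  by move=> x y; apply: same_fraction_unique (fP _) _; apply: same_fractionB.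
split; first exact: same_fraction_unique (fP _) same_fraction1.
by move=> x y; apply: same_fraction_unique (fP _) _; apply: same_fractionM.
Qed.

End TwoLocalizations.

(** The fraction [s^-1 r] of one localization corresponds to the fraction
    [s^-1 r] of the other; this relation is symmetric in the two rings, so it is
    the graph of a morphism both ways. *)
Lemma localization_unique (L1 L2 : left_localization S) : ring_iso L1 L2.
Proof.
have [f [fB fM fP]] := same_fraction_morphism L1 L2.
have [g [gB gM gP]] := same_fraction_morphism L2 L1.
have sym (K1 K2 : left_localization S) (x : K1) (y : K2) :
    same_fraction x y -> same_fraction y x.
  by move=> [s [r [Ss sx sy]]]; exists s, r.
apply: (ring_iso_intro fB fM); exists g => x.
  exact: same_fraction_unique (gP _) (sym _ _ _ _ (fP x)).
exact: same_fraction_unique (fP _) (sym _ _ _ _ (gP x)).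
Qed.

Lemma localization_isI (L : left_localization S) (P : pzRingType -> Prop) :
  (forall A B, ring_iso A B -> P A -> P B) -> P L -> localization_is S P.
Proof.
move=> isoP PL; split; first exact: inhabits L.
by move=> Q; apply: isoP PL; apply: localization_unique.
Qed.

End LocalizationUnique.

(** * Extension and contraction of ideals *)

Section Extension.
Variables (R : pzRingType) (C : set R) (L : left_localization C).
Implicit Types J K : set R.

Let Cmul : multiplicative_set C. Proof. exact: (loc_denominator L).1.1. Qed.
Let CM s t : C s -> C t -> C (s * t). Proof. by case: Cmul => _ + _; apply. Qed.
Let Core r s : C s -> exists t x, C t /\ t * r = x * s.
Proof. by move=> Cs; apply: (loc_denominator L).1.2. Qed.

Definition extension J : set L :=
  [set q | exists c j, [/\ C c, J j & loc_map L c * q = loc_map L j]].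

Lemma extension_map J j : J j -> extension J (loc_map L j).
Proof. by move=> Jj; exists 1, j; split; rewrite ?rmorph1 ?mul1r //; case: Cmul. Qed.

Lemma extension_left J : left_ideal J -> left_ideal (extension J).
Proof.
move=> hJ; split.
- by have := extension_map (left_ideal0 hJ); rewrite rmorph0.
- move=> x y [c [j [Cc Jj cx]]] [d [k [Cd Jk dy]]].
  have [t [z [Ct tz]]] := Core c Cd; exists (t * c), (t * j + z * k); split.
  + exact: CM.
  + by apply: left_idealD => //; apply: left_idealM.
  + by rewrite mulrDr {2}tz !rmorphM -!mulrA cx dy rmorphD !rmorphM.
- move=> q x [c [j [Cc Jj cx]]]; have [d [r [Cd dq]]] := loc_frac q.
  have [t [z [Ct tz]]] := Core r Cc; exists (t * d), (z * j); split.
  + exact: CM.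
  + exact: left_idealM.
  + by rewrite mulrA rmorphM -(mulrA (loc_map L t)) dq -rmorphM tz !rmorphM -mulrA cx.
Qed.

(** The chain of the left ideals [extension J * d ^+ n] stops, so that
    [extension J] is stable under right division by [d]. *)
Lemma extension_two_sided J : left_artinian L -> two_sided_ideal J ->
  two_sided_ideal (extension J).
Proof.
move=> artL hJ; have lE := extension_left (two_sided_left hJ); split=> //.
have mulR r x : extension J x -> extension J (x * loc_map L r).
  move=> [c [j [Cc Jj cx]]]; exists c, (j * r); split=> //.
    exact: two_sidedMr.
  by rewrite mulrA cx rmorphM.
have divR d u x : C d -> loc_map L d * u = 1 -> u * loc_map L d = 1 ->
    extension J x -> extension J (x * u).
  move=> Cd du ud Ex; pose D := loc_map L d.
  have [n|n _ [y Ey ->]|n /(_ _ (leqnSn n)) En] :=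
      artL (fun n => [set z | exists2 y, extension J y & z = y * D ^+ n]).
  - split; first by exists 0; [exact: left_ideal0|rewrite mul0r].
    + move=> _ _ [y Ey ->] [z Ez ->].
      by exists (y + z); [exact: left_idealD|rewrite mulrDl].
    + by move=> r _ [y Ey ->]; exists (r * y); [exact: left_idealM|rewrite mulrA].
  - by exists (y * D); [exact: mulR|rewrite exprS mulrA].
  have [y Ey xy] : [set z | exists2 y, extension J y & z = y * D ^+ n.+1] (x * D ^+ n).
    by rewrite En; exists x.
  have cancelD m z w : z * D ^+ m = w * D ^+ m -> z = w.
    elim: m z w => [|m IH] z w; first by rewrite expr0 !mulr1.
    rewrite exprSr !mulrA => E; apply: IH.
    by rewrite -[LHS]mulr1 -du mulrA E -mulrA du mulr1.
  suff -> : x * u = y by [].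
  have -> : x = y * D by apply: (cancelD n); rewrite xy exprS mulrA.
  by rewrite -mulrA du mulr1.
move=> q x Ex; have [d [r [Cd dq]]] := loc_frac q.
have [u [ud du]] := loc_inv L Cd.
have -> : q = u * loc_map L r by rewrite -dq mulrA ud mul1r.
by rewrite mulrA; apply: mulR; apply: (divR d).
Qed.

Lemma extension_contraction (P : set L) q :
  left_ideal P -> P q -> extension (loc_map L @^-1` P) q.
Proof.
move=> hP Pq; have [c [r [Cc cq]]] := loc_frac q; exists c, r; split=> //.
by rewrite /preimage /= -cq; apply: left_idealM.
Qed.

Lemma extension_sub J (P : set L) :
  left_ideal P -> J `<=` loc_map L @^-1` P -> extension J `<=` P.
Proof.
move=> hP JP q [c [j [Cc Jj cq]]].
by apply: (invertible_left_ideal hP (loc_inv L Cc)); rewrite cq; apply: JP.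
Qed.

Lemma loc_map_eq r s : loc_map L r = loc_map L s -> ass C (r - s).
Proof. by move=> E; apply/(loc_ker L); rewrite rmorphB E subrr. Qed.

Lemma extension1 J : left_ideal J -> ass C `<=` J -> extension J 1 ->
  exists2 c, C c & J c.
Proof.
move=> hJ aJ [c [j [Cc Jj]]]; rewrite mulr1 => /loc_map_eq/aJ cj.
by exists c => //; rewrite -(subrK j c); apply: left_idealD.
Qed.

(** Products of extensions are governed by the products of the ideals because
    [x * y] with [d * y = k] equals [(x / d) * k]. *)
Lemma contraction_prime (P : set L) : left_artinian L -> prime_ideal P ->
  prime_ideal (loc_map L @^-1` P).
Proof.
move=> artL prP; have hP := prime_two_sided prP; have lP := two_sided_left hP.
split.
- exact: two_sided_preimage.
- apply/eqP => pT; apply: (prime_not1 prP).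
  rewrite -(rmorph1 (loc_map L)) -[P _]/((loc_map L @^-1` P) 1).
  by rewrite pT.
- move=> J K hJ hK JK.
  have EJ := extension_two_sided artL hJ; have EK := extension_two_sided artL hK.
  have [_ _ primeP] := prP.
  have [x y Ex [d [k [Cd Kk dy]]]|sub|sub] := primeP _ _ EJ EK.
  + have [u [ud du]] := loc_inv L Cd.
    have [c [j [Cc Jj cx]]] : extension J (x * u) by apply: two_sidedMr.
    apply: (invertible_left_ideal lP (loc_inv L Cc)).
    have -> : x * y = x * u * loc_map L k by rewrite -dy mulrA -(mulrA x) ud mulr1.
    by rewrite mulrA cx -rmorphM; apply: JK.
  + by left=> j Jj; apply: sub; apply: extension_map.
  + by right=> j Jj; apply: sub; apply: extension_map.
Qed.

End Extension.
Arguments extension {R C} L J.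

(** * Maximal left denominator sets *)

(** The extension of [ass T] to the simple ring is proper, since a common
    element of [S] and [ass T] would give [0] in [T]; hence it is zero. *)
Lemma ass_above_simple (R : pzRingType) (S T : set R) (L : left_localization S) :
  simple_artinian L -> left_denominator T -> S `<=` T -> ass T = ass S.
Proof.
move=> [[_ simL] [artL _]] denT ST.
have hT := ass_two_sided denT.1; have lT := two_sided_left hT.
have assST : ass S `<=` ass T by move=> r [s Ss sr]; exists s => //; apply: ST.
apply/seteqP; split=> // r Tr.
have [E0|ET] := simL _ (extension_two_sided artL hT).
  apply/(loc_ker L); rewrite -[_ = 0]/([set 0] (loc_map L r)) -E0.
  exact: extension_map.
have [|c Sc Tc] := @extension1 _ _ L _ lT assST; first by rewrite ET.
by have := multiplicative_ass denT.1.1 (ST c Sc).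
Qed.

Lemma regular_mod_maximal (R : pzRingType) (p : set R)
    (L : left_localization (regular_mod p)) :
  simple_artinian L -> ass (regular_mod p) = p ->
  max_left_denominator R (regular_mod p).
Proof.
move=> simL assp; split; first exact: loc_denominator L.
move=> T denT ST; apply/seteqP; split=> // t Tt.
by rewrite -{1}assp -(ass_above_simple simL denT ST); apply: denominator_regular_mod.
Qed.

(** * Rings with a semisimple Artinian left localization *)

Section SemisimpleLocalization.
Variables (R : pzRingType) (C : set R) (L : left_localization C).
Hypothesis ssartL : semisimple_artinian L.

Let ssL : semisimple L. Proof. by case: ssartL. Qed.
Let artL : left_artinian L. Proof. by case: ssartL => _ []. Qed.

Lemma loc_ass_sub (J : set L) : left_ideal J -> ass C `<=` loc_map L @^-1` J.
Proof. by move=> hJ r /(loc_ker L); rewrite /preimage /= => ->; apply: left_ideal0. Qed.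

Lemma prime_contains_contraction p : prime_ideal p -> ass C `<=` p ->
  exists2 P : set L, prime_ideal P & loc_map L @^-1` P `<=` p.
Proof.
move=> prp ap.
have /finite_seqP [s sE] := semisimple_artinian_primes_finite ssL artL.
have sP P : P \in s -> prime_ideal P.
  by move=> Ps; rewrite -[prime_ideal P]/([set P | prime_ideal P] P) sE.
have [I|x hx|_ /mapP [P Ps ->] Pp] :=
    @prime_contains_factor _ p [seq loc_map L @^-1` P | P <- s] prp.
- move=> /mapP [P Ps ->]; exact: two_sided_preimage (prime_two_sided (sP P Ps)).
- apply/ap/(loc_ker L)/(semisimple_primes_separate ssL) => P prP.
  apply: (hx (loc_map L @^-1` P)); apply: map_f.
  by have : [set P | prime_ideal P] P by []; rewrite sE.
- by exists P => //; apply: sP.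
Qed.

(** Every prime ideal over [ass C] contains the contraction of a prime of the
    localization, and distinct primes have incomparable contractions. *)
Lemma minimal_primes_contraction :
  minimal_primes (ass C) = [set loc_map L @^-1` P | P in [set P | prime_ideal P]].
Proof.
apply/seteqP; split=> [p [prp ap minp]|_ [P prP <-]].
  have [P prP Pp] := prime_contains_contraction prp ap; exists P => //.
  apply: minp => //; first exact: contraction_prime.
  exact: loc_ass_sub (two_sided_left (prime_two_sided prP)).
have lP := two_sided_left (prime_two_sided prP).
split; [exact: contraction_prime|exact: loc_ass_sub|].
move=> p prp ap pP; apply/seteqP; split=> //.
have [P' prP' P'p] := prime_contains_contraction prp ap.
rewrite (semisimple_prime_incl ssL prP' prP) // => q P'q.
apply: (extension_sub lP (subset_trans P'p pP)).
by apply: extension_contraction P'q; apply/two_sided_left/prime_two_sided.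
Qed.

Lemma finite_minimal_primes : finite_set (minimal_primes (ass C)).
Proof.
rewrite minimal_primes_contraction; apply: finite_image.
exact: semisimple_artinian_primes_finite.
Qed.

Lemma semiprime_ass : semiprime_ideal (ass C).
Proof.
split; first exact: ass_two_sided (loc_denominator L).1.
move=> J hJ JJ x Jx; apply/(loc_ker L).
apply: (semisimple_primes_separate ssL) => P prP.
have [_ _ primeC] := contraction_prime artL prP.
have lP := two_sided_left (prime_two_sided prP).
have [y z Jy Jz|sub|sub] := primeC J J hJ hJ; [|exact: sub|exact: sub].
by apply: loc_ass_sub => //; apply: JJ.
Qed.

Section ProperIdeal.
Variables (J : set L).
Hypothesis hJ : two_sided_ideal J.

Lemma quotient_artinian : artinian (quotient J).
Proof.
by case: ssartL => _; apply: (@artinian_image _ _ (quotient_map J)) => q;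
  apply: quotient_map_surj.
Qed.

Lemma quotient_fraction (q : quotient J) : exists s r,
  C s /\ quotient_map J (loc_map L s) * q = quotient_map J (loc_map L r).
Proof.
have [x <-] := quotient_map_surj q; have [s [r [Cs sx]]] := loc_frac x.
by exists s, r; rewrite -rmorphM sx.
Qed.

Lemma contraction_regular_mod c : regular_mod (loc_map L @^-1` J) c <->
  invertible (quotient_map J (loc_map L c)).
Proof.
apply: (@regular_mod_kernel _ _ (quotient_map J \o loc_map L)) => //.
- by case: quotient_artinian.
- exact: two_sided_preimage.
- by move=> r; apply: quotient_map0.
- move=> q; have [s [r [Cs sq]]] := quotient_fraction q; exists s, r; split=> //.
  exact: invertible_morph (loc_inv L Cs).
Qed.

Lemma sub_contraction_regular_mod : C `<=` regular_mod (loc_map L @^-1` J).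
Proof.
by move=> c Cc; apply/contraction_regular_mod/invertible_morph/loc_inv.
Qed.

End ProperIdeal.

Lemma contraction_regular_mod_sub (J J' : set L) :
  two_sided_ideal J -> two_sided_ideal J' -> J `<=` J' ->
  regular_mod (loc_map L @^-1` J) `<=` regular_mod (loc_map L @^-1` J').
Proof.
move=> hJ hJ' JJ' c /(contraction_regular_mod hJ)[u].
have [x <-] := quotient_map_surj u; rewrite -!rmorphM -(rmorph1 (quotient_map J)).
rewrite !quotient_map_eq ideal_gen_id // => -[/JJ' ux /JJ' xu].
by apply/(contraction_regular_mod hJ'); apply: quotient_invertible ux xu.
Qed.

Lemma quotient_simple_artinian (P : set L) :
  prime_ideal P -> simple_artinian (quotient P).
Proof.
move=> prP; have hP := prime_two_sided prP; split; last exact: quotient_artinian.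
split=> [|J hJ].
  by rewrite -(rmorph1 (quotient_map P)) => /(quotient_map0 hP); apply: prime_not1.
have hJ' := two_sided_preimage (quotient_map P) hJ.
have lJ := two_sided_left hJ.
have PJ : P `<=` quotient_map P @^-1` J.
  by move=> x /(quotient_map0 hP); rewrite /preimage /= => ->; apply: left_ideal0.
have [JT|/eqP JnT] := pselect (J = setT); [by right|left].
have JE : quotient_map P @^-1` J = P.
  apply: (semisimple_prime_maximal ssL) => //; apply: contra_neq JnT => preT.
  apply: left_ideal1 => //; rewrite -(rmorph1 (quotient_map P)).
  by rewrite -[J _]/((quotient_map P @^-1` J) 1) preT.
apply/seteqP; split=> [q|_ ->]; last exact: left_ideal0.
have [x <-] := quotient_map_surj q => Jx; apply/(quotient_map0 hP).
by rewrite -JE.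
Qed.

(** The identity element [e] of [P] is central in the localization, and [1 - e]
    is a fraction whose numerator kills [P] and is invertible modulo [P]. *)
Lemma ass_contraction_regular_mod (P : set L) :
  prime_ideal P -> ass (regular_mod (loc_map L @^-1` P)) = loc_map L @^-1` P.
Proof.
move=> prP; have hP := prime_two_sided prP.
have [[_ CM _] _] := (loc_denominator L).1.
apply/seteqP; split=> [r [s /(contraction_regular_mod hP) invs sr]|r Pr].
  apply/(quotient_map0 hP)/(invertible_mul0 invs).
  by rewrite -!rmorphM sr !rmorph0.
have [e [Pe unit_e _]] := semisimple_ideal_unit ssL hP.
have [s [t [Cs st]]] := loc_frac (1 - e).
have [u Cu utr] : ass C (t * r).
  apply/(loc_ker L); rewrite rmorphM -st -mulrA mulrBl mul1r.
  by have [-> _] := unit_e _ Pr; rewrite subrr mulr0.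
exists (u * t); last by rewrite -mulrA.
apply/(contraction_regular_mod hP); rewrite rmorphM -st mulrA -rmorphM.
rewrite (rmorphM (quotient_map P)).
rewrite [X in _ * X](_ : _ = 1).
  by rewrite mulr1; apply: invertible_morph; apply: loc_inv; apply: CM.
by rewrite rmorphB rmorph1 /= (proj2 (quotient_map0 hP e)) // subr0.
Qed.

Lemma contraction_localization (P : set L) : prime_ideal P ->
  exists L' : left_localization (regular_mod (loc_map L @^-1` P)),
    ring_iso (quotient P) L'.
Proof.
move=> prP; have hP := prime_two_sided prP.
have regE := contraction_regular_mod hP.
apply: (@localization_intro _ _ _ (quotient_map P \o loc_map L)).
- split.
  + by apply/regE; rewrite !rmorph1; apply: invertible1.
  + move=> s t /regE invs /regE invt; apply/regE.
    by rewrite !rmorphM; apply: invertibleM.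
  + move=> /regE [u [+ _]]; rewrite !rmorph0 mulr0 => /esym.
    by have [[]] := quotient_simple_artinian prP.
- by move=> s /regE.
- move=> q; have [s [r [Cs sq]]] := quotient_fraction q.
  by exists s, r; split=> //; apply: sub_contraction_regular_mod.
- by move=> r; rewrite ass_contraction_regular_mod //; apply: quotient_map0.
Qed.

Lemma contraction_localization_is (P : set L) : prime_ideal P ->
  localization_is (regular_mod (loc_map L @^-1` P)) simple_artinian.
Proof.
move=> prP; have [L' isoL'] := contraction_localization prP.
apply: (localization_isI simple_artinian_iso (L := L')).
exact: simple_artinian_iso isoL' (quotient_simple_artinian prP).
Qed.

Lemma contraction_maximal_denominator (P : set L) : prime_ideal P ->
  max_left_denominator R (regular_mod (loc_map L @^-1` P)).
Proof.
move=> prP; have [[L'] simL] := contraction_localization_is prP.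
exact: regular_mod_maximal (simL L') (ass_contraction_regular_mod prP).
Qed.

Lemma loc_regular_mod c : regular_mod (ass C) c <-> invertible (loc_map L c).
Proof.
apply: regular_mod_kernel => //.
- exact: ass_two_sided (loc_denominator L).1.
- exact: loc_ker.
- move=> q; have [s [r [Cs sq]]] := loc_frac q; exists s, r; split=> //.
  exact: loc_inv.
Qed.

(** The elements of [T] are regular modulo [ass T], hence invertible modulo the
    extension of [ass T] as soon as the latter contracts to [ass T], and then
    modulo every prime above it. *)
Lemma denominator_sub_regular_mod (T : set R) : left_denominator T ->
  ~ extension L (ass T) 1 ->
  (forall r, extension L (ass T) (loc_map L r) -> ass T r) ->
  exists2 P : set L, prime_ideal P & T `<=` regular_mod (loc_map L @^-1` P).
Proof.
move=> denT nE1 EcT; have hT := ass_two_sided denT.1.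
have hE := extension_two_sided artL hT.
have [|P prP EP] := prime_above_proper ssL hE.
  by apply/eqP => ET; apply: nE1; rewrite ET.
exists P => // t Tt; apply: (contraction_regular_mod_sub hE (prime_two_sided prP) EP).
rewrite (_ : _ @^-1` _ = ass T); first exact: denominator_regular_mod.
apply/seteqP; split=> r; first exact: EcT.
exact: extension_map.
Qed.

Let max_denominators_above (T : set R) (P : set L) : prime_ideal P ->
  max_left_denominator R T -> T `<=` regular_mod (loc_map L @^-1` P) ->
  [set regular_mod p | p in minimal_primes (ass C)] T.
Proof.
move=> prP [denT maxT] TP; rewrite minimal_primes_contraction.
exists (loc_map L @^-1` P); first by exists P.
by apply: maxT => //; case: (contraction_maximal_denominator prP).
Qed.

Lemma max_denominators_containing :
  [set T | max_left_denominator R T /\ C `<=` T] =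
  [set regular_mod p | p in minimal_primes (ass C)].
Proof.
apply/seteqP; split=> [T [maxT CT]|_ [p minp <-]]; last first.
  move: minp; rewrite minimal_primes_contraction => -[P prP <-].
  split; first exact: contraction_maximal_denominator.
  exact/sub_contraction_regular_mod/prime_two_sided.
have [denT _] := maxT; have hT := ass_two_sided denT.1.
have assCT : ass C `<=` ass T by move=> r [c Cc cr]; exists c => //; apply: CT.
have [E1|r [c [j [Cc Tj]]]|P prP TP] := @denominator_sub_regular_mod T denT.
- have [c Cc Tc] := extension1 (two_sided_left hT) assCT E1.
  exact: multiplicative_ass denT.1.1 (CT c Cc) Tc.
- rewrite -rmorphM => /loc_map_eq/assCT crj.
  have [t Tt tcr] : ass T (c * r).
    by rewrite -(subrK j (c * r)); apply: left_idealD => //; apply: two_sided_left.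
  exists (t * c); last by rewrite -mulrA.
  by have [[_ TM _] _] := denT.1; apply: TM => //; apply: CT.
- exact: max_denominators_above TP.
Qed.

(** When [C] consists of regular elements, the central identity element [e] of
    the extension of [ass T] satisfies [s * e = 0] for some [s] in [T]: a
    numerator of [e] is killed by some [s], and denominators are invertible.
    Hence [s] kills every element whose image lies in the extension. *)
Lemma max_denominators_regular : (forall c, C c -> regular R c) ->
  max_left_denominator R = [set regular_mod p | p in minimal_primes (ass C)].
Proof.
move=> regC; apply/seteqP; split=> [T maxT|_ [p minp <-]]; last first.
  move: minp; rewrite minimal_primes_contraction => -[P prP <-].
  exact: contraction_maximal_denominator.
have [denT _] := maxT; have hT := ass_two_sided denT.1.
have inj_loc r : loc_map L r = 0 -> r = 0.
  by move=> /loc_ker [c /regC [_ cancel] /cancel].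
have [E1|r Er|P prP TP] := @denominator_sub_regular_mod T denT.
- have [||c Cc [t Tt tc]] := @extension1 _ _ L (ass T) _ _ E1.
  + exact: two_sided_left.
  + move=> r /(loc_ker L)/inj_loc ->.
    exact: left_ideal0 (two_sided_left hT).
  + have [_ _ T0] := denT.1.1; apply: T0.
    by have [cancel _] := regC c Cc; rewrite -(cancel t tc).
- have [e [[c [b [Cc [s Ts sb] ce]]] unit_e central_e]] :=
    semisimple_ideal_unit ssL (extension_two_sided artL hT).
  have se : loc_map L s * e = 0.
    apply: (invertible_mul0r (loc_inv L Cc)).
    by rewrite -mulrA central_e mulrA -mulrA ce -rmorphM sb rmorph0.
  exists s => //; apply: inj_loc; rewrite rmorphM.
  by have [<- _] := unit_e _ Er; rewrite mulrA se mul0r.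
- exact: max_denominators_above TP.
Qed.

End SemisimpleLocalization.

(** * Localizations of quotient rings *)

Lemma quotient_lift (R A : pzRingType) (I : set R) (f : {rmorphism R -> A}) :
  two_sided_ideal I -> (forall x, I x -> f x = 0) ->
  exists g : {rmorphism quotient I -> A}, forall x, g (quotient_map I x) = f x.
Proof.
move=> hI fI0; have [rep repK] := choice (@quotient_map_surj R I).
have fE x : f (rep (quotient_map I x)) = f x.
  apply/eqP; rewrite -subr_eq0 -rmorphB; apply/eqP/fI0.
  by apply/(quotient_map0 hI); rewrite rmorphB /= repK subrr.
have gB : zmod_morphism (f \o rep).
  by move=> p q; rewrite -(repK p) -(repK q) -rmorphB /= !fE rmorphB.
have gM : monoid_morphism (f \o rep).
  split; first by rewrite -(rmorph1 (quotient_map I)) /= fE rmorph1.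
  by move=> p q; rewrite -(repK p) -(repK q) -rmorphM /= !fE rmorphM.
pose gA := GRing.isZmodMorphism.Build _ _ (f \o rep) gB.
pose gR := GRing.isMonoidMorphism.Build _ _ (f \o rep) gM.
by exists (HB.pack (f \o rep) gA gR : {rmorphism quotient I -> A}).
Qed.

Lemma multiplicative_regular_mod (R : pzRingType) (p : set R) :
  two_sided_ideal p -> ~ p 1 -> multiplicative_set (regular_mod p).
Proof.
move=> hp np1; have lp := two_sided_left hp; split.
- by apply/(regular_modP hp); split=> x; rewrite ?mulr1 ?mul1r.
- move=> s t /(regular_modP hp) [sl sr] /(regular_modP hp) [tl tr].
  apply/(regular_modP hp); split=> x; first by rewrite mulrA => /tl/sl.
  by rewrite -mulrA => /sr/tr.
- move=> /(regular_modP hp) [/(_ 1) + _]; rewrite mulr0 => /(_ (left_ideal0 lp)).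
  exact: np1.
Qed.

(** Killing a part of [ass S] beforehand does not change the localization, and
    the denominators may be enlarged as long as they become invertible. *)
Lemma quotient_localization (R : pzRingType) (S I : set R)
    (L : left_localization S) (T : set (quotient I)) :
  two_sided_ideal I -> I `<=` ass S -> multiplicative_set T ->
  (forall s, S s -> T (quotient_map I s)) ->
  (forall x, T (quotient_map I x) -> invertible (loc_map L x)) ->
  exists L' : left_localization T, ring_iso L L'.
Proof.
move=> hI IS mulT ST invT.
have [x /IS/(loc_ker L) //|g gE] := @quotient_lift _ _ _ (loc_map L) hI.
apply: (@localization_intro _ _ _ g) => // [q|q|q].
- by have [x <-] := quotient_map_surj q; rewrite gE; apply: invT.
- have [s [r [Ss sq]]] := loc_frac q.
  by exists (quotient_map I s), (quotient_map I r); rewrite !gE; split=> //; apply: ST.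
- have [x <-] := quotient_map_surj q; rewrite gE; split=> [/loc_ker [s Ss sx]|[t]].
    by exists (quotient_map I s); [exact: ST|rewrite -rmorphM sx rmorph0].
  have [y <-] := quotient_map_surj t => Ty.
  rewrite -rmorphM => /(quotient_map0 hI)/IS/(loc_ker L); rewrite rmorphM.
  exact: invertible_mul0 (invT y Ty).
Qed.

Section QuotientPrime.
Variables (R : pzRingType) (I p : set R).
Hypotheses (hI : two_sided_ideal I) (hp : two_sided_ideal p) (Ip : I `<=` p).

Lemma quotient_imageE x : (quotient_map I @` p) (quotient_map I x) <-> p x.
Proof.
split=> [[y py]|px]; last by exists x.
rewrite quotient_map_eq ideal_gen_id // => /Ip pyx.
have lp := two_sided_left hp; rewrite -(subKr y x); exact: left_idealB.
Qed.

Lemma quotient_image_two_sided : two_sided_ideal (quotient_map I @` p).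
Proof.
have lp := two_sided_left hp; split; first split.
- by exists 0; [exact: left_ideal0|rewrite rmorph0].
- move=> _ _ [x px <-] [y py <-].
  by exists (x + y); [exact: left_idealD|rewrite rmorphD].
- move=> r _ [x px <-]; have [s <-] := quotient_map_surj r.
  by exists (s * x); [exact: left_idealM|rewrite rmorphM].
- move=> r _ [x px <-]; have [s <-] := quotient_map_surj r.
  by exists (x * s); [exact: two_sidedMr|rewrite rmorphM].
Qed.

Lemma quotient_regular_mod x :
  regular_mod (quotient_map I @` p) (quotient_map I x) <-> regular_mod p x.
Proof.
split.
  move=> /(regular_modP quotient_image_two_sided) [rl rr].
  apply/(regular_modP hp); split=> y py; apply/quotient_imageE.
    by apply: rl; rewrite -rmorphM; apply/quotient_imageE.
  by apply: rr; rewrite -rmorphM; apply/quotient_imageE.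
move=> /(regular_modP hp) [rl rr].
apply/(regular_modP quotient_image_two_sided); split=> q.
  have [y <-] := quotient_map_surj q; rewrite -rmorphM => /quotient_imageE/rl py.
  exact/quotient_imageE.
have [y <-] := quotient_map_surj q; rewrite -rmorphM => /quotient_imageE/rr py.
exact/quotient_imageE.
Qed.

End QuotientPrime.

(** An element [c] regular modulo [ass C] becomes invertible in [L], and writing
    its inverse as [s^-1 r] gives [r * c = s] modulo [ass C]. *)
Lemma localization_dense (R : pzRingType) (C : set R) (L : left_localization C) :
  semisimple_artinian L ->
  dense_in (quotient_map (ass C) @` C) (regular (quotient (ass C))).
Proof.
move=> ssL; have [oreC _] := loc_denominator L; have ha := ass_two_sided oreC.
have [[C1 CM C0] _] := oreC.
have na1 : ~ ass C 1 by apply: multiplicative_ass C1; case: oreC.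
have subC : quotient_map (ass C) @` C `<=` regular (quotient (ass C)).
  by move=> _ [c Cc <-]; apply/(loc_regular_mod ssL)/loc_inv.
have mulreg : multiplicative_set (regular (quotient (ass C))).
  have [reg1 regM reg0] := multiplicative_regular_mod ha na1; split.
  - by rewrite -(rmorph1 (quotient_map (ass C))).
  - move=> s t; have [x <-] := quotient_map_surj s; have [y <-] := quotient_map_surj t.
    by rewrite -rmorphM; apply: regM.
  - by rewrite -(rmorph0 (quotient_map (ass C))).
split=> //.
  split; first by exists 1; rewrite ?rmorph1.
    by move=> _ _ [x Cx <-] [y Cy <-]; exists (x * y); rewrite ?rmorphM //; apply: CM.
  by move=> /subC; case: mulreg.
move=> q; have [t <-] := quotient_map_surj q => /(loc_regular_mod ssL) [u [ut tu]].
have [s [r [Cs su]]] := loc_frac u; exists (quotient_map (ass C) r), s => //.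
rewrite -rmorphM; apply/quotient_map_eq; rewrite ideal_gen_id //.
by apply: (@loc_map_eq _ _ L); rewrite rmorphM -su -mulrA ut mulr1.
Qed.

(** * Finite products of rings *)

Section Product.
Variables (I : Type) (Q : I -> pzRingType).
Local Notation prod := (ring_product Q).

Lemma product_morphism (R : pzRingType) (f : forall i, {rmorphism R -> Q i}) :
  exists g : {rmorphism R -> prod}, forall r i, g r i = f i r.
Proof.
pose g r : prod := fun i => f i r.
have gB : zmod_morphism g.
  by move=> x y; apply: functional_extensionality_dep => i; exact: rmorphB.
have gM : monoid_morphism g.
  split; first by apply: functional_extensionality_dep => i; exact: rmorph1.
  by move=> x y; apply: functional_extensionality_dep => i; exact: rmorphM.
pose gA := GRing.isZmodMorphism.Build _ _ g gB.
pose gR := GRing.isMonoidMorphism.Build _ _ g gM.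
by exists (HB.pack g gA gR : {rmorphism R -> prod}).
Qed.

Lemma product_invertible (x : prod) :
  (forall i, invertible (x i)) -> invertible x.
Proof.
move=> invx; pose u : prod := fun i => sval (cid (invx i)).
have uP i : u i * x i = 1 /\ x i * u i = 1 by exact: svalP (cid (invx i)).
by exists u; split; apply: functional_extensionality_dep => i; case: (uP i).
Qed.

Definition factor_unit (i : I) : prod := fun j => if `[< j = i >] then 1 else 0.

Lemma factor_unit_mul i (x : prod) : (factor_unit i * x) i = x i.
Proof.
rewrite -[LHS]/(factor_unit i i * x i) /factor_unit.
by case: asboolP => // _; rewrite mul1r.
Qed.

Lemma factor_unit_mul0 i j (x : prod) : j <> i -> (factor_unit i * x) j = 0.
Proof.
rewrite -[(factor_unit i * x) j]/(factor_unit i j * x j) /factor_unit.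
by case: asboolP => // _ _; rewrite mul0r.
Qed.

Lemma product_component i (x : Q i) : exists b : prod, b i = x.
Proof.
pose b : prod := fun j => if pselect (i = j) is left E then eq_rect i Q x j E else 0.
exists b; rewrite /b; case: pselect => // E.
by rewrite (Prop_irrelevance E erefl).
Qed.

Definition projection (J : set prod) i : set (Q i) := [set b i | b in J].
Arguments projection J i : clear implicits.

Lemma projection_left J i : left_ideal J -> left_ideal (projection J i).
Proof.
move=> hJ; split.
- by exists 0; first exact: left_ideal0.
- move=> _ _ [x Jx <-] [y Jy <-].
  by exists (x + y); first exact: left_idealD.
- move=> r _ [x Jx <-]; have [s <-] := product_component r.
  by exists (s * x); first exact: left_idealM.
Qed.

Hypothesis finI : finite_set [set: I].

Let finite_cover : exists s : seq {classic I}, forall i, i \in s.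
Proof.
have /(@finite_seqP {classic I}) [s sE] := finI; exists s => i.
by rewrite -[is_true _]/([set` s] i) -sE.
Qed.

(** A left ideal of a finite product is the product of its projections: its
    elements can be changed one component at a time. *)
Lemma product_glue (J : set prod) (b : prod) :
  left_ideal J -> (forall i, projection J i (b i)) -> J b.
Proof.
move=> hJ Jb; have [s sI] := finite_cover.
suff [c Jc cb] : exists2 c : prod, J c & forall i : {classic I}, i \in s -> c i = b i.
  suff <- : c = b by [].
  by apply: functional_extensionality_dep => i; apply: cb.
elim: s {sI} => [|i s [c Jc cb]]; first by exists 0; first exact: left_ideal0.
have [d Jd di] := Jb i; exists (c + factor_unit i * (d - c)).
  by apply: left_idealD => //; apply: left_idealM => //; apply: left_idealB.
move=> j; rewrite -[LHS]/(c j + (factor_unit i * (d - c)) j).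
have [->|ji] := pselect (j = i).
  by rewrite factor_unit_mul -[(d - c) i]/(d i - c i) addrC subrK.
by rewrite factor_unit_mul0 // addr0 inE => /predU1P [//|]; apply: cb.
Qed.

Lemma product_left_artinian : (forall i, left_artinian (Q i)) -> left_artinian prod.
Proof.
move=> artQ J hJ dJ.
have stop i : exists n, forall m, (n <= m)%N -> projection (J m) i = projection (J n) i.
  apply: (artQ i (fun n => projection (J n) i)) => n; first exact: projection_left.
  by move=> _ [b Jb <-]; exists b => //; apply: dJ.
have [N NP] : exists N, forall i m, (N <= m)%N ->
    projection (J m) i = projection (J N) i.
  have [s sI] := finite_cover.
  suff [N NP] : exists N, forall i : {classic I}, i \in s ->
      forall m, (N <= m)%N -> projection (J m) i = projection (J N) i.
    by exists N => i; apply: NP.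
  elim: s {sI} => [|i s [N NP]]; first by exists 0%N.
  have [n nP] := stop i; exists (maxn N n) => j.
  rewrite inE => /predU1P [->|js] m; rewrite geq_max => /andP[Nm nm].
    by rewrite !nP // leq_maxr.
  by rewrite !(NP j js) // leq_maxl.
exists N => m Nm; apply/seteqP; split=> b Jb; apply: product_glue => // i.
  by rewrite -(NP i m Nm); exists b.
by rewrite (NP i m Nm); exists b.
Qed.

Lemma product_semisimple : (forall i, semisimple (Q i)) -> semisimple prod.
Proof.
move=> ssQ; apply/semisimpleP => L hL ML; apply: left_ideal1 => //.
apply: product_glue => // i.
pose Li : set (Q i) :=
  [set x | exists b, [/\ L b, b i = x & forall j, j <> i -> b j = 0]].
suff [b [Lb bi _]] : Li 1 by exists b.
have hLi : left_ideal Li.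
  split; first by exists 0; split=> //; apply: left_ideal0.
    move=> _ _ [b [Lb <- b0]] [c [Lc <- c0]]; exists (b + c); split=> //.
      exact: left_idealD.
    by move=> j ji; rewrite -[LHS]/(b j + c j) b0 // c0 // addr0.
  move=> r _ [b [Lb <- b0]]; have [s <-] := product_component r.
  exists (s * b); split=> //; first exact: left_idealM.
  by move=> j ji; rewrite -[LHS]/(s j * b j) b0 // mulr0.
have /semisimpleP /(_ _ hLi) -> // := ssQ i.
move=> M [hM nM0 minM] m Mm.
(* The copy of [M] supported at [i]. *)
pose M' : set prod := [set b | M (b i) /\ forall j, j <> i -> b j = 0].
have M'single x : M x -> exists2 b, M' b & b i = x.
  move=> Mx; have [b bx] := product_component x; exists (factor_unit i * b).
    by split; [rewrite factor_unit_mul bx|move=> j; apply: factor_unit_mul0].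
  by rewrite factor_unit_mul.
have M'eq (b c : prod) : (forall j, j <> i -> b j = 0) ->
    (forall j, j <> i -> c j = 0) -> b i = c i -> b = c.
  move=> b0 c0 bc; apply: functional_extensionality_dep => j.
  by have [->//|ji] := pselect (j = i); rewrite b0 // c0.
have minM' : minimal_left_ideal M'.
  split.
  - split; first by split=> //; apply: left_ideal0.
      move=> b c [Mb b0] [Mc c0]; split; first exact: left_idealD.
      by move=> j ji; rewrite -[LHS]/(b j + c j) b0 // c0 // addr0.
    move=> r b [Mb b0]; split; first exact: left_idealM.
    by move=> j ji; rewrite -[LHS]/(r j * b j) b0 // mulr0.
  - move=> M'0; apply: nM0; apply/seteqP; split=> [x Mx|_ ->]; last exact: left_ideal0.
    by have [b + <-] := M'single x Mx; rewrite M'0 => ->.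
  - move=> J hJ JM'.
    have [||J0|JM] := minM (projection J i); first exact: projection_left.
    + by move=> _ [b /JM' [Mb _] <-].
    + left; apply/seteqP; split=> [b Jb|_ ->]; last exact: left_ideal0.
      have [_ b0] := JM' b Jb; apply: M'eq => //.
      by rewrite -[_ = _]/([set 0] (b i)) -J0; exists b.
    + right; apply/seteqP; split=> // b [Mb b0].
      have [c Jc cb] : projection J i (b i) by rewrite JM.
      suff -> : b = c by [].
      by have [_ c0] := JM' c Jc; apply: M'eq.
by have [b M'b bm] := M'single m Mm; exists b; split=> //; [exact: ML M'b|case: M'b].
Qed.

End Product.

Lemma product_semisimple_artinian (I : Type) (Q : I -> pzRingType) :
  finite_set [set: I] ->
  (forall i, simple_artinian (Q i)) -> semisimple_artinian (ring_product Q).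
Proof.
move=> finI simQ; split; last split.
- apply: product_semisimple => // i; have [sim [art _]] := simQ i.
  exact: simple_left_artinian_semisimple.
- by apply: product_left_artinian => // i; case: (simQ i) => _ [].
- have art : left_artinian (ring_product (fun i => (Q i)^c : pzRingType)).
    by apply: product_left_artinian => // i; case: (simQ i) => _ [].
  apply: (@left_artinian_image _ _ (fun b : ring_product (fun i => (Q i)^c : pzRingType)
    => b : (ring_product Q)^c) _ _ _ art) => // b.
  by exists b.
Qed.

(** * The product of the simple localizations *)

Lemma minimal_prime_separation (R : pzRingType) (a p : set R) :
  finite_set (minimal_primes a) -> minimal_primes a p ->
  exists x, ~ p x /\ forall q, minimal_primes a q -> q <> p -> q x.
Proof.
move=> /finite_seqP [s sE] minp; apply: contrapT => /forallNP none.
have sP q : q \in s -> minimal_primes a q by move=> qs; rewrite sE.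
have [prp _ incl] := minp.
have [q|x hx|q] := @prime_contains_factor _ p [seq q <- s | q != p] prp.
- by rewrite mem_filter => /andP [_ /sP [/prime_two_sided]].
- apply: contrapT => npx; apply: (none x); split=> // q minq /eqP qp.
  by apply: hx; rewrite mem_filter qp /=; have : minimal_primes a q by []; rewrite sE.
- rewrite mem_filter => /andP [/eqP qp /sP [prq aq _]] qsub.
  by apply: qp; apply: incl.
Qed.

Section ProductLocalization.
Variables (R : pzRingType) (C a : set R).
Hypotheses (aE : a = ass C) (mulC : multiplicative_set C).
Hypotheses (semia : semiprime_ideal a) (fina : finite_set (minimal_primes a)).
Variable Q : forall p : {p : set R | minimal_primes a p},
  left_localization (regular_mod (sval p)).
Hypothesis assQ : forall p, minimal_primes a p -> ass (regular_mod p) = p.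
Hypothesis simQ : forall p, simple_artinian (Q p).
Hypothesis denseC : dense_in (quotient_map a @` C) (regular (quotient a)).

Local Notation index := {p : set R | minimal_primes a p}.

Let ha : two_sided_ideal a. Proof. by case: semia. Qed.
Let hmin p : minimal_primes a p -> two_sided_ideal p.
Proof. by case=> /prime_two_sided. Qed.

Let index_inj (p q : index) : sval p = sval q -> p = q.
Proof. by case: p q => [p hp] [q hq] /= pq; exact: eq_exist. Qed.

Lemma index_finite : finite_set [set: index].
Proof.
rewrite (_ : setT = (@sval _ _) @^-1` (minimal_primes a)).
  by apply: finite_preimage => // p q _ _; apply: index_inj.
by apply/seteqP; split=> // -[p hp].
Qed.

Lemma component_ker (p : index) r : loc_map (Q p) r = 0 <-> sval p r.
Proof.
have assp := assQ (svalP p); split=> [/(loc_ker (Q p))|pr]; first by rewrite assp.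
by apply/(loc_ker (Q p)); rewrite assp.
Qed.

Lemma components_ker r : (forall p, loc_map (Q p) r = 0) <-> a r.
Proof.
split=> [r0|ar p]; last by apply/component_ker; case: (svalP p) => _ + _; apply.
apply: (semiprime_bigcap_minimal semia) => p minp.
exact/(component_ker (exist _ p minp)).
Qed.

(** The intersection of the other minimal primes is not contained in [p], so
    that its extension to the simple ring [Q p] is everything. *)
Lemma component_unit (p : index) : exists e,
  invertible (loc_map (Q p) e) /\ forall q : index, q <> p -> loc_map (Q q) e = 0.
Proof.
pose J := [set x | forall q, minimal_primes a q -> q <> sval p -> q x].
have lmin q : minimal_primes a q -> left_ideal q by move=> /hmin/two_sided_left.
have hJ : two_sided_ideal J.
  split; first split.
  - by move=> q minq _; apply: left_ideal0; apply: lmin.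
  - move=> x y hx hy q minq qp.
    by apply: left_idealD; [exact: lmin|exact: hx|exact: hy].
  - by move=> r x hx q minq qp; apply: left_idealM; [exact: lmin|exact: hx].
  - by move=> r x hx q minq qp; apply: two_sidedMr; [exact: hmin|exact: hx].
have [x [npx Jx]] := minimal_prime_separation fina (svalP p).
have [[_ simp] [artp _]] := simQ p.
have [E0|ET] := simp _ (extension_two_sided artp hJ).
  case: npx; apply/component_ker.
  by rewrite -[_ = 0]/([set 0] (loc_map (Q p) x)) -E0; apply: extension_map.
have [c [e [Sc Je]]] : extension (Q p) J 1 by rewrite ET.
rewrite mulr1 => ce; exists e; split; first by rewrite -ce; apply: loc_inv.
move=> q qp; apply/component_ker; apply: Je; first exact: svalP.
by move=> /index_inj.
Qed.

(** Multiplying by the [component_unit] [e] of [p] on the appropriate side puts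
    the product in the other minimal primes, at which nothing is assumed. *)
Lemma regular_mod_component c (p : index) :
  regular_mod a c -> regular_mod (sval p) c.
Proof.
move=> /(regular_modP ha) [rl rr]; have [e [inve e0]] := component_unit p.
apply/(regular_modP (hmin (svalP p))); split=> x /component_ker pxc.
- have /rl/components_ker/(_ p) : a (e * x * c).
    apply/components_ker => q; rewrite -mulrA rmorphM.
    have [->|qp] := pselect (q = p); first by rewrite pxc mulr0.
    by rewrite e0 // mul0r.
  by rewrite rmorphM => /(invertible_mul0 inve)/component_ker.
- have /rr/components_ker/(_ p) : a (c * (x * e)).
    apply/components_ker => q; rewrite mulrA rmorphM.
    have [->|qp] := pselect (q = p); first by rewrite pxc mul0r.
    by rewrite e0 // mulr0.
  by rewrite rmorphM => /(invertible_mul0r inve)/component_ker.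
Qed.

(** The denominators [e * s], with [s] a denominator of the [p]-component and
    [e] the [component_unit] of [p], vanish in the other components and so add
    up to a common denominator. *)
Lemma common_denominator (b : ring_product (fun p => loc_ring (Q p))) :
  exists c r, forall p, invertible (loc_map (Q p) c) /\
    loc_map (Q p) c * b p = loc_map (Q p) r.
Proof.
have /(@finite_seqP {classic index}) [s sE] := index_finite.
have sT (p : {classic index}) : p \in s by rewrite -[is_true _]/([set` s] p) -sE.
suff [c [r [crs _]]] : exists c r,
    (forall p : {classic index}, p \in s -> invertible (loc_map (Q p) c) /\
      loc_map (Q p) c * b p = loc_map (Q p) r) /\
    (forall p : {classic index}, p \notin s ->
      loc_map (Q p) c = 0 /\ loc_map (Q p) r = 0).
  by exists c, r => p; apply: crs.
(* Vanishing outside [s] lets the next pair be added without disturbing the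
   components already treated. *)
elim: s {sE sT} => [|p s [c [r [crs cr0]]]].
  by exists 0, 0; split=> // p _; rewrite !rmorph0.
have [ps|nps] := boolP (p \in s).
  exists c, r; split=> q; first by rewrite inE => /predU1P [->|]; apply: crs.
  by rewrite inE negb_or => /andP [_]; apply: cr0.
have [t [x [St tb]]] := loc_frac (b p); have [e [inve e0]] := component_unit p.
exists (c + e * t), (r + e * x); split=> q; rewrite inE; last first.
  rewrite negb_or => /andP [/eqP qp /cr0 [c0 r0]].
  by rewrite !rmorphD c0 r0 !rmorphM e0 // !mul0r !addr0.
have [->|qp] := pselect (q = p).
  move=> _; have [c0 r0] := cr0 p nps; rewrite !rmorphD c0 r0 !add0r !rmorphM.
  by split; [apply: invertibleM inve (loc_inv _ St)|rewrite -mulrA tb].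
move=> /predU1P [//|qs]; have [invc cb] := crs q qs.
by rewrite !rmorphD !rmorphM e0 // !mul0r !addr0.
Qed.

Lemma product_localization : exists L : left_localization C,
  ring_iso (ring_product (fun p => loc_ring (Q p))) L.
Proof.
have [_ _ subC dense] := denseC.
have [f fE] := @product_morphism _ (fun p => loc_ring (Q p)) R (fun p => loc_map (Q p)).
have kerf r : f r = 0 <-> a r.
  rewrite -components_ker; split=> [fr0 p|r0]; first by rewrite -fE fr0.
  by apply: functional_extensionality_dep => p; rewrite fE r0.
apply: (@localization_intro _ _ _ f) => // [c Cc|b|r]; last by rewrite kerf aE.
  apply: product_invertible => p; rewrite fE; apply: loc_inv.
  by apply: regular_mod_component; apply: subC; exists c.
have [c [r crb]] := common_denominator b.
have [t [d Cd]] : exists t, (quotient_map a @` C) (t * quotient_map a c).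
  apply: dense; apply/(regular_modP ha).
  split=> x /components_ker xc; apply/components_ker => p; have [invc _] := crb p.
    by apply: (invertible_mul0r invc); rewrite -rmorphM; apply: xc.
  by apply: (invertible_mul0 invc); rewrite -rmorphM; apply: xc.
have [u <-] := quotient_map_surj t; rewrite -rmorphM => /quotient_map_eq.
rewrite ideal_gen_id // => aduc; exists d, (u * r); split=> //.
apply: functional_extensionality_dep => p.
rewrite -[LHS]/(f d p * b p) !fE rmorphM.
have [_ <-] := crb p; rewrite mulrA -rmorphM; congr (_ * _).
apply/eqP; rewrite -subr_eq0 -rmorphB; apply/eqP.
exact: (proj2 (components_ker _) aduc p).
Qed.

End ProductLocalization.

(** * The equivalence and the decompositions *)

Lemma left_regular_multiplicative (R : pzRingType) :
  ~ left_regular R 0 -> multiplicative_set (left_regular R).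
Proof.
move=> reg0; split=> //; first by move=> x; rewrite mulr1.
by move=> s t regs regt x; rewrite mulrA => /regt/regs.
Qed.

Lemma ass_regular (R : pzRingType) : ass (regular R) = [set 0].
Proof.
apply/seteqP; split=> [r [s [_ cancel] /cancel]//|_ ->].
by exists 1; rewrite ?mulr0 //; split=> x; rewrite ?mulr1 ?mul1r.
Qed.

Lemma inhabited_forall (I : Type) (T : I -> Type) :
  (forall i, inhabited (T i)) -> inhabited (forall i, T i).
Proof.
move=> inhT; have ex i : exists _ : T i, True by have [t] := inhT i; exists t.
by apply: inhabits => i; have [] := cid (ex i).
Qed.

(** Modulo [ass C] the denominators can be enlarged to all regular elements,
    which are invertible in [L]. *)
Lemma quotient_regular_localization (R : pzRingType) (C : set R)
    (L : left_localization C) : semisimple_artinian L ->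
  exists L' : left_localization (regular (quotient (ass C))), ring_iso L L'.
Proof.
move=> ssL; have [_ mulreg subC _] := localization_dense ssL.
apply: quotient_localization => //.
- exact: ass_two_sided (loc_denominator L).1.
- by move=> s Cs; apply: subC; exists s.
- by move=> x /(loc_regular_mod ssL).
Qed.

Theorem theorem3p3 (R : pzRingType) :
  let C' := left_regular R in
  let a := ass C' in
  let Rbar : pzRingType := quotient a in
  let MinRbar := minimal_primes [set (0 : Rbar)] in
  let cond1 := localization_is C' semisimple_artinian in
  let cond2 :=
    [/\ (* (a) *)
        semiprime_ideal a /\ finite_set (minimal_primes a),
        (* (b) *)
        (forall p, minimal_primes a p ->
           left_denominator (regular_mod p) /\ ass (regular_mod p) = p),
        (* (c) *)
        (forall p, minimal_primes a p ->
           localization_is (regular_mod p) simple_artinian)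
      & (* (d) *)
        dense_in (quotient_map a @` C') (regular Rbar)] in
  (cond1 <-> cond2) /\
  (cond1 \/ cond2 ->
   [/\ (* (i) *)
       [set S | max_left_denominator R S /\ C' `<=` S]
         = [set regular_mod p | p in minimal_primes a] /\
       (forall p, minimal_primes a p -> ass (regular_mod p) = p),
       (* (ii) *)
       max_left_denominator Rbar = [set regular_mod q | q in MinRbar] /\
       (forall q, MinRbar q -> ass (regular_mod q) = q),
       (* (iii) *)
       (forall p, minimal_primes a p ->
          let pbar : set Rbar := quotient_map a @` p in
          localization_is (regular_mod p) (fun Q =>
            localization_is (regular_mod pbar) (fun Qbar =>
              ring_iso Q Qbar /\ simple_artinian Q /\ simple_artinian Qbar)))
     & (* (iv) *)
       [/\ inhabited (left_localization C'),
           (forall p : {p : set R | minimal_primes a p},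
              inhabited (left_localization (regular_mod (sval p)))),
           (forall q : {q : set Rbar | MinRbar q},
              inhabited (left_localization (regular_mod (sval q)))),
           inhabited (left_localization (regular Rbar))
         & forall (Q : left_localization C')
             (Qp : forall p : {p : set R | minimal_primes a p},
                left_localization (regular_mod (sval p)))
             (Qq : forall q : {q : set Rbar | MinRbar q},
                left_localization (regular_mod (sval q)))
             (Qcl : left_localization (regular Rbar)),
           let prodR : pzRingType :=
             ring_product (fun p => loc_ring (Qp p)) in
           let prodRbar : pzRingType :=
             ring_product (fun q => loc_ring (Qq q)) in
           [/\ ring_iso Q prodR, ring_iso prodR prodRbar,
               ring_iso prodRbar Qcl
             & [/\ semisimple_artinian Q, semisimple_artinian prodR,
                   semisimple_artinian prodRbar & semisimple_artinian Qcl]]]]).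
Proof.
move=> C' a Rbar MinRbar cond1 cond2.
have cond12 : cond1 -> cond2.
  move=> [[L] /(_ L) ssL]; have minE := minimal_primes_contraction ssL.
  split.
  - by split; [exact: semiprime_ass ssL|exact: finite_minimal_primes ssL].
  - move=> p; rewrite minE => -[P prP <-]; split.
      have [[L'] _] := contraction_localization_is ssL prP.
      exact: loc_denominator L'.
    exact: ass_contraction_regular_mod.
  - move=> p; rewrite minE => -[P prP <-]; exact: contraction_localization_is.
  - exact: localization_dense ssL.
have product_iso : cond2 -> forall Qp : (forall p : {p : set R | minimal_primes a p},
      left_localization (regular_mod (sval p))),
    (exists L : left_localization C',
      ring_iso (ring_product (fun p => loc_ring (Qp p))) L)
    /\ semisimple_artinian (ring_product (fun p => loc_ring (Qp p))).
  move=> [[semia fina] denp simp dense] Qp.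
  have simQ p : simple_artinian (Qp p) by have [_] := simp _ (svalP p); apply.
  split.
    apply: (product_localization (a := a)) => //; last by move=> p /denp [].
    apply: left_regular_multiplicative => reg0.
    have [[_ _ +] _ _ _] := dense; apply.
    by exists 0 => //; apply: rmorph0.
  exact: product_semisimple_artinian (index_finite fina) simQ.
have cond21 : cond2 -> cond1.
  move=> c2; have [_ _ simp _] := c2.
  have [|Qp] := @inhabited_forall {p : set R | minimal_primes a p}
    (fun p => left_localization (regular_mod (sval p))).
    by move=> p; have [] := simp _ (svalP p).
  have [[L isoL] ssprod] := product_iso c2 Qp.
  apply: (localization_isI semisimple_artinian_iso (L := L)).
  exact: semisimple_artinian_iso isoL ssprod.
split; first by split.
move=> c12; have c1 : cond1 by case: c12 => // /cond21.
have c2 := cond12 c1; have [[L] /(_ L) ssL] := c1.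
have [[semia fina] denp simp dense] := c2.
have [Lbar isoLbar] := quotient_regular_localization ssL.
have ssLbar : semisimple_artinian Lbar := semisimple_artinian_iso isoLbar ssL.
have minbarE := minimal_primes_contraction ssLbar.
have MinE : MinRbar = minimal_primes (ass (regular Rbar)) by rewrite ass_regular.
have assq q : MinRbar q -> ass (regular_mod q) = q.
  rewrite MinE minbarE => -[P prP <-]; exact: ass_contraction_regular_mod.
have simq q : MinRbar q -> localization_is (regular_mod q) simple_artinian.
  rewrite MinE minbarE => -[P prP <-]; exact: contraction_localization_is.
split.
- split; first exact: max_denominators_containing ssL.
  by move=> p /denp [].
- split=> //; rewrite MinE; apply: (max_denominators_regular ssLbar) => //.
- move=> p minp pbar; have [inhQ simQ] := simp p minp; split=> // Q.
  have [[prp ap _] [_ assp]] := (minp, denp p minp).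
  have hp := prime_two_sided prp; have [ha _] := semia.
  have [] := @quotient_localization _ _ a Q (regular_mod pbar) ha.
  + by rewrite assp.
  + apply: multiplicative_regular_mod; first exact: quotient_image_two_sided.
    rewrite -(rmorph1 (quotient_map a)) => /(quotient_imageE ha hp ap).
    exact: prime_not1.
  + by move=> s Ss; apply/(quotient_regular_mod ha hp ap).
  + by move=> x /(quotient_regular_mod ha hp ap); apply: loc_inv.
  move=> Qbar isoQ; split; first exact: inhabits Qbar.
  move=> Qbar'; have isoQ' := ring_iso_trans isoQ (localization_unique Qbar Qbar').
  by split=> //; split; [exact: simQ|exact: simple_artinian_iso isoQ' (simQ Q)].
- split.
  + exact: inhabits L.
  + by move=> p; have [] := simp _ (svalP p).
  + by move=> q; have [] := simq _ (svalP q).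
  + exact: inhabits Lbar.
  move=> Q Qp Qq Qcl prodR prodRbar.
  have [[L1 iso1] ssprodR] := product_iso c2 Qp.
  have isoQ : ring_iso Q prodR.
    exact: ring_iso_trans (localization_unique Q L1) (ring_iso_sym iso1).
  have finMin : finite_set MinRbar by rewrite MinE; exact: finite_minimal_primes ssLbar.
  have simQq q : simple_artinian (Qq q) by have [_] := simq _ (svalP q); apply.
  have ssprodRbar : semisimple_artinian prodRbar.
    exact: product_semisimple_artinian (index_finite finMin) simQq.
  have [L2 iso2] : exists L2 : left_localization (regular Rbar), ring_iso prodRbar L2.
    apply: (product_localization (a := [set 0])) => //.
    * by rewrite ass_regular.
    * by case: dense.
    * by rewrite -ass_regular; apply: semiprime_ass ssLbar.
    * by rewrite -ass_regular; apply: localization_dense ssLbar.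
  have isoCl : ring_iso prodRbar Qcl.
    exact: ring_iso_trans iso2 (localization_unique L2 Qcl).
  have isoQcl : ring_iso Q Qcl.
    apply: ring_iso_trans (localization_unique Q L) _.
    exact: ring_iso_trans isoLbar (localization_unique Lbar Qcl).
  have iso12 : ring_iso prodR prodRbar.
    apply: ring_iso_trans (ring_iso_sym isoQ) _.
    exact: ring_iso_trans isoQcl (ring_iso_sym isoCl).
  split=> //; split=> //.
    exact: semisimple_artinian_iso (ring_iso_sym isoQ) ssprodR.
  exact: semisimple_artinian_iso isoCl ssprodRbar.
Qed.
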